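(* Let $N\ge2$, let $\Omega=A_{l,L}\subset\mathbb{R}^N$ with $0\le l<L$, and let $r^*:=\big(\frac{L^N+l^N}{2}\big)^{1/N}$. If $D$ is a minimizer of $h_{rad}(\Omega)$, then $D=A_{l,r^*}$ or $D=A_{r^*,L}$. Moreover, $$h_{rad}(\Omega)=2^{1/N}N\,\frac{(L^N+l^N)^{\frac{N-1}{N}}}{L^N-l^N}.$$
   Context: For $0\le s<t$, $A_{s,t}:=B_t(0)\setminus B_s(0)\subset\mathbb{R}^N$, where $B_r(0)$ is the ball of radius $r$ centered at the origin and $B_0(0)=\emptyset$ (so $A_{0,t}=B_t(0)$). $|A|$ is Lebesgue measure; sets are identified when they differ by a null set. $P(D;\Omega):=|D\chi_D|(\Omega)$ is the relative perimeter (total variation of $\chi_D$ in the interior of $\Omega$). The radial constant is $$h_{rad}(\Omega):=\inf\Big\{\frac{P(D;\Omega)}{|D|}:\ D\subset\Omega\text{ is radially symmetric and }0<|D|\le\frac{|\Omega|}{2}\Big\},$$ and a minimizer is an admissible set attaining the infimum. *)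

(* Defs.v *)
From HB Require Import structures.
From mathcomp Require Import all_boot all_order all_algebra.
From mathcomp Require Import all_classical all_reals all_analysis.

Set Implicit Arguments.
Unset Strict Implicit.
Unset Printing Implicit Defensive.

Import Order.TTheory GRing.Theory Num.Theory.
Import numFieldNormedType.Exports.

Local Open Scope classical_set_scope.
Local Open Scope ring_scope.

(* R^n is 'rV[R]_n, with the sigma-algebra generated by the coordinates (i.e.
   the Borel sets), as the library does for n.-tuple. *)
Section measurable_rV.
Context {R : realType} (n : nat).

Let coors (i : 'I_n) (x : 'rV[R]_n) : measurableTypeR R := x 0 i.

Let rV_set0 : g_sigma_preimage coors set0.
Proof. exact: sigma_algebra0. Qed.

Let rV_setC A : g_sigma_preimage coors A -> g_sigma_preimage coors (~` A).
Proof. exact: sigma_algebraC. Qed.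

Let rV_bigcup (F : (set 'rV[R]_n)^nat) :
  (forall i, g_sigma_preimage coors (F i)) ->
  g_sigma_preimage coors (\bigcup_i F i).
Proof. exact: sigma_algebra_bigcup. Qed.

HB.instance Definition _ := @isMeasurable.Build 
  (measure_tuple_display (R.-ocitv.-measurable).-sigma)
  'rV[R]_n (g_sigma_preimage coors) rV_set0 rV_setC rV_bigcup.

End measurable_rV.

Section lebesgue_measure_rV.
Context {R : realType}.

Definition cons_rV n (p : measurableTypeR R * 'rV[R]_n) : 'rV[R]_n.+1 :=
  row_mx (p.1 : R)%:M p.2.

Fixpoint lebesgue_rV n : set 'rV[R]_n -> \bar R :=
  match n with
  | 0 => \d_ (0 : 'rV[R]_0)
  | n'.+1 => pushforward (lebesgue_measure \x @lebesgue_rV n')%E (@cons_rV n')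
  end.

Lemma measurable_coord_rV n (i : 'I_n) :
  measurable_fun setT (fun x : 'rV[R]_n => x 0 i : measurableTypeR R).
Proof.
move=> _ Y mY; rewrite setTI; apply: sub_sigma_algebra => /=.
rewrite -bigcup_seq/=; exists i => /=; first by rewrite mem_index_enum.
by exists Y => //; rewrite setTI.
Qed.

Lemma measurable_fun_rV d (T : measurableType d) n (f : T -> 'rV[R]_n) :
  (forall i, measurable_fun setT (fun x => f x 0 i : measurableTypeR R)) ->
  measurable_fun setT f.
Proof.
move=> mf; apply: (measurability (\big[setU/set0]_(i < n) preimage_set_system setT
  (fun x : 'rV[R]_n => x 0 i : measurableTypeR R) measurable)) => //.
move=> _ [A + <-]; rewrite -bigcup_seq/= => -[i _ [B mB <-]].
by rewrite [X in _ `&` X]setTI; exact: mf.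
Qed.

Lemma measurable_cons_rV n : measurable_fun setT (@cons_rV n).
Proof.
apply: measurable_fun_rV => i; rewrite /cons_rV.
have [j ->|j ->] := @split_ordP 1 n i.
- rewrite (_ : (fun x => _) = fst); first exact: measurable_fst.
  by apply/funext => x; rewrite (row_mxEl (x.1 : R)%:M x.2) ord1 mxE eqxx mulr1n.
- rewrite (_ : (fun x => _) =
    (fun x : _ * 'rV[R]_n => x.2 0 j : measurableTypeR R)).
    exact: (measurableT_comp (measurable_coord_rV j) measurable_snd).
  by apply/funext => x; rewrite (row_mxEr (x.1 : R)%:M x.2).
Qed.

Lemma measurable_uncons_rV n : measurable_fun setT
  (fun x : 'rV[R]_n.+1 => (x 0 0 : measurableTypeR R, rsubmx (x : 'rV_(1 + n)))).
Proof.
apply: measurable_fun_pair; first exact: measurable_coord_rV.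
apply: measurable_fun_rV => i; under eq_fun do rewrite mxE.
exact: measurable_coord_rV.
Qed.

Lemma lebesgue_rV_sigma_finite n :
  exists m : {sigma_finite_measure set 'rV[R]_n -> \bar R},
    @lebesgue_rV n = m :> (set 'rV[R]_n -> \bar R).
Proof.
elim: n => [|n [m mE]]; first by exists (\d_ (0 : 'rV[R]_0)).
pose mu := pushforward (lebesgue_measure \x m)%E (@cons_rV n).
have -> : @lebesgue_rV n.+1 = mu by rewrite /mu /= mE.
have mf := @measurable_cons_rV n.
have sf : sigma_finite setT mu.
  have /sigma_finiteP[F [FT ndF Foo]] := sigma_finiteT (@lebesgue_measure R).
  have /sigma_finiteP[G [GT ndG Goo]] := sigma_finiteT m.
  pose g (x : 'rV[R]_n.+1) :=
    (x 0 0 : measurableTypeR R, rsubmx (x : 'rV_(1 + n))).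
  exists (fun k => g @^-1` (F k `*` G k)).
    rewrite -preimage_bigcup (_ : \bigcup_i _ = setT)//.
    rewrite -subTset => -[x y] _.
    have [i _ Fix] : (\bigcup_i F i) x by rewrite -FT.
    have [j _ Gjy] : (\bigcup_i G i) y by rewrite -GT.
    exists (maxn i j) => //; split => /=.
    - by move: x Fix; exact/subsetPset/ndF/leq_maxl.
    - by move: y Gjy; exact/subsetPset/ndG/leq_maxr.
  move=> k; have [mF Fk] := Foo k; have [mG Gk] := Goo k.
  have mFG : measurable (F k `*` G k) by exact: measurableX.
  split; first by rewrite -[X in measurable X]setTI; exact: measurable_uncons_rV.
  rewrite /mu /pushforward -comp_preimage (_ : g \o _ = id).
    by rewrite preimage_id product_measure1E// lte_mul_pinfty// ge0_fin_numE.
  apply/funext => -[x y]; rewrite /g /cons_rV /= row_mxKr.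
  congr pair; transitivity (row_mx (x : R)%:M y 0 (lshift n 0)).
    by congr (row_mx _ _ _ _); exact/val_inj.
  by rewrite row_mxEl mxE eqxx.
pose nu : {measure set 'rV[R]_n.+1 -> \bar R} :=
  pushforward (lebesgue_measure \x m)%E (@cons_rV n).
pose nu' : {sigma_finite_measure set 'rV[R]_n.+1 -> \bar R} :=
  HB.pack (Measure.sort (nu mf)) (Measure_isSigmaFinite.Build _ _ _ (nu mf) sf).
by exists nu'.
Qed.

Let m n := projT1 (cid (@lebesgue_rV_sigma_finite n)).

Let mE n : @lebesgue_rV n = m n := projT2 (cid (@lebesgue_rV_sigma_finite n)).

Let lebesgue_rV0 n : lebesgue_rV (set0 : set 'rV[R]_n) = 0%E.
Proof. by rewrite mE measure0. Qed.

Let lebesgue_rV_ge0 n (A : set 'rV[R]_n) : (0 <= lebesgue_rV A)%E.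
Proof. by rewrite mE measure_ge0. Qed.

Let lebesgue_rV_semi_sigma_additive n : semi_sigma_additive (@lebesgue_rV n).
Proof. by rewrite mE; exact: measure_semi_sigma_additive. Qed.

Let lebesgue_rV_sigma_finiteT n : sigma_finite setT (@lebesgue_rV n).
Proof. by rewrite mE; exact: sigma_finiteT. Qed.

HB.instance Definition _ n := isMeasure.Build _ _ _ (@lebesgue_rV n)
  (@lebesgue_rV0 n) (@lebesgue_rV_ge0 n) (@lebesgue_rV_semi_sigma_additive n).

HB.instance Definition _ n := Measure_isSigmaFinite.Build _ _ _
  (@lebesgue_rV n) (@lebesgue_rV_sigma_finiteT n).

End lebesgue_measure_rV.

Section perimeter.
Context {R : realType} {N : nat}.
Implicit Types (x : 'rV[R]_N) (D U Omega : set 'rV[R]_N).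

(* The library norm of 'rV[R]_N is the sup norm; it induces the same topology. *)
Definition enorm x : R := Num.sqrt (\sum_(i < N) x 0 i ^+ 2).

Definition eball (r : R) : set 'rV[R]_N := [set x | enorm x < r].

Definition annulus (s t : R) : set 'rV[R]_N := eball t `\` eball s.

Definition partial (i : 'I_N) (f : 'rV[R]_N -> R) x : R := 'D_(delta_mx 0 i) f x.

Definition divergence (phi : 'rV[R]_N -> 'rV[R]_N) x : R :=
  \sum_(i < N) partial i (fun y => phi y 0 i) x.

Definition C1_field (phi : 'rV[R]_N -> 'rV[R]_N) : Prop :=
  (forall x, differentiable phi x) /\
  forall i j : 'I_N, continuous (partial i (fun y => phi y 0 j)).

Definition supp (phi : 'rV[R]_N -> 'rV[R]_N) : set 'rV[R]_N :=
  closure [set x | phi x != 0].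

Definition test_fields U : set ('rV[R]_N -> 'rV[R]_N) :=
  [set phi | [/\ C1_field phi, compact (supp phi), supp phi `<=` U
               & forall x, enorm (phi x) <= 1]].

(* |Du|(U) for U open; [total_variation] in the library is the 1-dimensional
   notion. *)
Definition grad_variation (u : 'rV[R]_N -> R) U : \bar R :=
  ereal_sup [set (\int[@lebesgue_rV R N]_(x in U) (u x * divergence phi x)%:E)%E
            | phi in test_fields U].

Definition perimeter D Omega : \bar R := grad_variation \1_D Omega°.

(* Sets are identified up to null sets; a class has a Borel representative, and
   one contained in Omega if it is contained in Omega up to a null set, so
   admissible sets are Borel subsets of Omega. Radial symmetry, however, is stated
   for the class: a set is radially symmetric when some
   representative has a membership that only depends on the norm. *)
Definition radially_symmetric D : Prop :=
  exists S : set 'rV[R]_N,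
    [/\ measurable S, forall x y, enorm x = enorm y -> S x -> S y
      & {ae @lebesgue_rV R N, forall x, D x <-> S x}].

Definition rad_admissible Omega : set (set 'rV[R]_N) :=
  [set D | [/\ measurable D, D `<=` Omega, radially_symmetric D,
               (0 < lebesgue_rV D)%E
             & (lebesgue_rV D <= lebesgue_rV Omega / 2%:E)%E]].

Definition h_rad Omega : \bar R :=
  ereal_inf [set (perimeter D Omega / lebesgue_rV D)%E
            | D in rad_admissible Omega].

Definition h_rad_minimizer Omega D : Prop :=
  rad_admissible Omega D /\ (perimeter D Omega / lebesgue_rV D)%E = h_rad Omega.

End perimeter.

(* Main.v *)
(* Let omega be the volume of the unit ball. The map x |-> |x|^N sends Lebesgue
   measure to omega times Lebesgue measure on [0, +oo), so that a radial set D is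
   described by a set E of reals in [l^N, L^N), with |D| = omega |E|.

   Upper bound: integrating a test field phi by parts against cut-offs of |x|^N
   shows that the integral of div phi over B_r is at most N omega r^(N-1).

   Lower bound: if E is not a.e. constant on (k^N, L^N), the fields
   Psi(|x|^N) x / |x|^N, whose divergence is N Psi'(|x|^N), give
   P(D) >= N omega k^(N-1): take |Psi| <= k^(N-1) varying only near a density point
   of E and a density point of its complement.

   Hence P(D) >= N omega b^(N-1), where b is the outermost boundary radius of D. If
   b >= r*, as is the case when D fills the part of Omega outside B_b, conclude with
   |D| <= |Omega| / 2. Otherwise D is null outside B_b, so |D| <= omega (b^N - l^N),
   and b^(N-1) / (b^N - l^N) is decreasing in b. *)

Require Import Defs.
From mathcomp Require Import all_boot all_order all_algebra.
From mathcomp Require Import all_classical all_reals all_analysis.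
From mathcomp Require Import measurable_realfun ring lra.

Set Implicit Arguments.
Unset Strict Implicit.
Unset Printing Implicit Defensive.

Import Order.TTheory GRing.Theory Num.Theory.
Import numFieldNormedType.Exports.

Local Open Scope classical_set_scope.
Local Open Scope ring_scope.

(** * Lebesgue measure of row vectors under affine maps *)

(** The perimeter is handled directly as a supremum over C^1 fields, and [E] stays an arbitrary
    Borel set of reals, so boundary radii have to be read off from measures. This is done by [F x],
    the measure of [E] beyond [x]: it is nonincreasing and 1-Lipschitz, and [E] is a.e. constant
    beyond [x] exactly when [F x] is 0 or [L^N - x]. With [m = r*^N], the midpoint of [l^N] and
    [L^N], the problem becomes a few inequalities between [F] and [x^((N-1)/N)]. The value and the
    rigidity come from one statement: an admissible set whose quotient is at most that of [A_{l,r*}]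
    has exactly this quotient and is one of the two annuli. Two obstacles shape the details. The
    lower bound at [k] needs [E] to vary strictly beyond [k], so the bound at the boundary radius
    itself is a limit from the left. And [|x|^N] need not be smooth at the origin, so every cut-off
    of it is constant near 0. *)

Section affine.
Context {R : realType}.
Notation leb := (@lebesgue_measure R).

Lemma measurable_affine (a b : R) :
  measurable_fun setT (fun t : measurableTypeR R => (a * t + b : measurableTypeR R)).
Proof.
apply: measurable_funD; last exact: measurable_cst.
by apply: measurable_funM; [exact: measurable_cst|exact: measurable_id].
Qed.

(** Uniqueness of Lebesgue measure: the preimage of []c, d]] has length [(d - c) / a], so [a] times
    the image measure agrees with Lebesgue measure on half-open intervals. *)
Lemma lebesgue_measure_affine (a b : R) (A : set (measurableTypeR R)) : 0 < a ->
  measurable A ->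
  leb ((fun t : measurableTypeR R => (a * t + b : measurableTypeR R)) @^-1` A) = ((a^-1)%:E * leb A)%E.
Proof.
move=> a0 mA.
pose f (t : measurableTypeR R) : measurableTypeR R := a * t + b.
have mf : measurable_fun setT f := measurable_affine a b.
pose nu : {measure set (measurableTypeR R) -> \bar R} := pushforward leb f.
have a0' : 0 <= a by exact: ltW.
pose mu : {measure set (measurableTypeR R) -> \bar R} := mscale (NngNum a0') (nu mf).
have -> // : leb A = mu A.
  apply: (lebesgue_measure_unique _ mA) => X [[c d] _ <-] /=.
  rewrite /mu /mscale /= /nu /pushforward.
  have -> : f @^-1` `]c, d] = `]((c - b) / a), ((d - b) / a)]%classic.
    apply/seteqP; split => x /=; rewrite !in_itv /= /f.
      by rewrite ltr_pdivrMr// ler_pdivlMr// ltrBlDr lerBrDr mulrC.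
    by rewrite ltr_pdivrMr// ler_pdivlMr// ltrBlDr lerBrDr mulrC.
  rewrite !lebesgue_measure_itv /= !lte_fin ltr_pM2r ?invr_gt0// ltrD2r.
  case: ifP => _; last by rewrite mule0.
  rewrite -!EFinD -EFinM; congr EFin.
  by rewrite -mulrBl opprB addrA subrK mulrC divfK// gt_eqF.
by rewrite /mu /mscale /= muleA -EFinM mulVf ?gt_eqF// mul1e.
Qed.

End affine.

Section rV.
Context {R : realType}.
Notation leb n := (@lebesgue_rV R n).

Lemma measurable_affine_rV n (a : R) (b : 'rV[R]_n) :
  measurable_fun setT (fun x : 'rV[R]_n => a *: x + b).
Proof.
apply: measurable_fun_rV => i; under eq_fun do rewrite !mxE.
exact: (measurableT_comp (measurable_affine a (b 0 i)) (measurable_coord_rV i)).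
Qed.

Lemma cons_rV0 n (p : measurableTypeR R * 'rV[R]_n) : cons_rV p 0 ord0 = p.1.
Proof.
rewrite /cons_rV (_ : ord0 = @lshift 1 n ord0); last exact/val_inj.
by rewrite (@row_mxEl _ _ 1) mxE eqxx mulr1n.
Qed.

Lemma cons_rV_lift n (p : measurableTypeR R * 'rV[R]_n) i :
  cons_rV p 0 (lift ord0 i) = p.2 0 i.
Proof.
rewrite /cons_rV (_ : lift ord0 i = @rshift 1 n i); last exact/val_inj.
by rewrite (@row_mxEr _ _ 1).
Qed.

Lemma lebesgue_rVS n (A : set 'rV[R]_n.+1) :
  leb n.+1 A = (\int[lebesgue_measure]_x leb n [set y | A (cons_rV (x, y))])%E.
Proof.
rewrite /= /pushforward /product_measure1; apply: eq_integral => x _ /=.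
by congr (lebesgue_rV _); rewrite /xsection; apply/funext => y /=; rewrite /mkset inE.
Qed.

(** Induction by slicing along the first coordinate: each slice contributes [a ^- n], and the change
    of variable in the outer integral gives the last factor [a^-1]. *)
Lemma lebesgue_rV_affine n (a : R) (b : 'rV[R]_n) (A : set 'rV[R]_n) : 0 < a ->
  measurable A ->
  leb n ((fun x => a *: x + b) @^-1` A) = ((a ^- n)%:E * leb n A)%E.
Proof.
move=> a0; elim: n b A => [|n IH] b A mA.
  rewrite expr0 invr1 mul1e /=; congr (\d_ _ _).
  by apply/funext => x /=; congr A; apply/rowP; case.
rewrite !lebesgue_rVS.
pose B := [set p : measurableTypeR R * 'rV[R]_n | A (cons_rV p)].
have mB : measurable B.
  by rewrite -[B]setTI; exact: measurable_cons_rV.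
pose b0 := b 0 0; pose b' := rsubmx (b : 'rV_(1 + n)).
pose h := (fun x : measurableTypeR R => leb n (xsection B x)).
have mh : measurable_fun setT h by exact: measurable_fun_xsection.
have sec x : xsection B x = [set y | A (cons_rV (x, y))].
  by rewrite /xsection; apply/funext => y /=; rewrite /mkset inE.
transitivity (\int[lebesgue_measure]_x ((a ^- n)%:E * h ((a * x + b0)%R)))%E.
  apply: eq_integral => x _.
  rewrite /h -(IH b'); last exact: measurable_xsection.
  rewrite sec; congr (lebesgue_rV _); apply/seteqP; split => y /=;
    suff -> : a *: cons_rV (x, y) + b = cons_rV (a * x + b0, a *: y + b') => //;
    apply/rowP => i; rewrite mxE; rewrite [X in X + _]mxE;
    case: (unliftP ord0 i) => [j|] ->; rewrite ?cons_rV0// !cons_rV_lift /= !mxE;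
    by congr (_ + b _ _); exact/val_inj.
rewrite ge0_integralZl//=; last by rewrite lee_fin invr_ge0 exprn_ge0// ltW.
  rewrite exprS invfM [a^-1 * _]mulrC EFinM -muleA; congr (_ * _)%E.
  have := @ge0_integral_pushforward _ _ _ _ R _ (measurable_affine a b0) lebesgue_measure setT h measurableT mh.
  rewrite preimage_setT /comp => <- //.
  have a1 : 0 <= a^-1 by rewrite invr_ge0 ltW.
  rewrite (@eq_measure_integral _ _ R setT (mscale (NngNum a1) lebesgue_measure)).
    rewrite ge0_integral_mscale//=; congr (_ * _)%E.
    by apply: eq_integral => x _; rewrite /h sec.
    exact: measurable_affine.
  by move=> ? B1 mB1 _; exact: lebesgue_measure_affine.
apply: measurableT_comp mh _; exact: measurable_affine.
Qed.

End rV.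

Section open_rV.
Context {R : realType}.

(** Measurability is generated by the coordinates, so an open set is written as a countable union of
    measurable boxes: those with rational centre and radius [1 / (k + 1)] that it contains. *)
Lemma open_measurable_rV n (A : set 'rV[R]_n) : open A -> measurable A.
Proof.
move=> oA.
pose box (p : 'rV[rat]_n * nat) : set 'rV[R]_n :=
  [set x | forall i, `|x 0 i - ratr (p.1 0 i)| < p.2.+1%:R^-1].
have mbox p : measurable (box p).
  rewrite (_ : box p = \bigcap_(i in [set: 'I_n])
      ((fun x : 'rV[R]_n => x 0 i : measurableTypeR R) @^-1`
        (ball (ratr (p.1 0 i) : R) p.2.+1%:R^-1))).
    apply: fin_bigcap_measurable => // i _; rewrite -[X in measurable X]setTI.
    by apply: measurable_coord_rV => //; exact: measurable_ball.
  apply/seteqP; split => x /= xp i; first by move=> _; rewrite /ball/= distrC.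
  by have := xp i I; rewrite /ball /= distrC.
rewrite (_ : A = \bigcup_p (if `[<box p `<=` A>] then box p else set0)).
  apply: countable_bigcupT_measurable; first exact: countableP.
  by move=> p; case: ifP.
apply/seteqP; split => x.
  move=> Ax; have /nbhs_ballP[e /= e0 eA] : nbhs x A by exact: open_nbhs_nbhs.
  have [k ke] : exists k : nat, k.+1%:R^-1 < e / 2.
    exists (Num.truncn (e / 2)^-1); rewrite -[ltRHS]invrK ltf_pV2 ?posrE// ?invr_gt0 ?divr_gt0//.
    exact: truncnS_gt.
  have /choice[f fP] (i : 'I_n) : exists r : rat, `|x 0 i - ratr r| < k.+1%:R^-1.
    have : x 0 i - k.+1%:R^-1 < x 0 i + k.+1%:R^-1.
      by rewrite ltrBlDr -addrA ltrDl addr_gt0.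
    move=> /rat_in_itvoo[r]; rewrite in_itv /= => /andP[r1 r2]; exists r.
    rewrite ltr_norml; move: r1 r2; set d := _^-1; set z := ratr r; move=> r1 r2.
 by apply/andP; split; lra.
  exists (\row_i f i, k) => //; rewrite asboolT; first by move=> i /=; rewrite mxE.
  move=> y /= yb; apply: eA; rewrite /ball /= /mx_ball; split => // i j.
  rewrite ord1 /ball /=; have := yb j; rewrite mxE => yj; have := fP j => xj.
  rewrite (_ : _ - _ = (x 0 j - ratr (f j)) - (y 0 j - ratr (f j))); last by ring.
  rewrite (le_lt_trans (ler_normB _ _))//; move: ke xj yj.
  by set z := ratr _; set d := _.+1%:R^-1; set u := `|_|; set v := `|_| => *; lra.
by move=> [p _]; case: ifPn => // /asboolP; apply.
Qed.

Lemma continuous_measurable_rV n (f : 'rV[R]_n -> R) : continuous f ->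
  measurable_fun setT (f : _ -> measurableTypeR R).
Proof.
move=> cf; apply: (measurability _ (RGenOpens.measurableE R)) => _ [_ [a [b ->] <-]].
by rewrite setTI; apply: open_measurable_rV; apply: open_comp.
Qed.

End open_rV.

(** * Balls, and the distribution of the N-th power of the norm *)

Section enorm.
Context {R : realType}.
Implicit Types (N : nat).

Definition sqnorm N (x : 'rV[R]_N) : R := \sum_(i < N) x 0 i ^+ 2.

Lemma sqnorm_ge0 N (x : 'rV[R]_N) : 0 <= sqnorm x.
Proof. by apply: sumr_ge0 => i _; exact: sqr_ge0. Qed.

Lemma continuous_sqnorm N : continuous (@sqnorm N).
Proof.
apply: continuous_big => [|i _ x]; first exact: add_continuous.
apply: (@continuous_comp _ _ _ (fun y : 'rV[R]_N => y 0 i) (fun t => t ^+ 2)).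
  exact: coord_continuous.
exact: exprn_continuous.
Qed.

Lemma enorm_ge0 N (x : 'rV[R]_N) : 0 <= enorm x.
Proof. exact: sqrtr_ge0. Qed.

Lemma sqr_enorm N (x : 'rV[R]_N) : enorm x ^+ 2 = sqnorm x.
Proof. by rewrite sqr_sqrtr// sqnorm_ge0. Qed.

Lemma continuous_enorm N : continuous (@enorm R N).
Proof.
move=> x; apply: (@continuous_comp _ _ _ (@sqnorm N) Num.sqrt).
  exact: continuous_sqnorm.
exact: sqrt_continuous.
Qed.

Lemma measurable_enorm N :
  measurable_fun setT (@enorm R N : _ -> measurableTypeR R).
Proof. by apply: continuous_measurable_rV; exact: continuous_enorm. Qed.

Lemma enormZ N (a : R) (x : 'rV[R]_N) : enorm (a *: x) = `|a| * enorm x.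
Proof.
rewrite /enorm -sqrtr_sqr -sqrtrM ?sqr_ge0// mulr_sumr; congr Num.sqrt.
by apply: eq_bigr => i _; rewrite mxE exprMn.
Qed.

Lemma coord_le_enorm N (x : 'rV[R]_N) i : `|x 0 i| <= enorm x.
Proof.
rewrite -sqrtr_sqr ler_sqrt ?sqnorm_ge0// (bigD1 i)//= lerDl.
by apply: sumr_ge0 => j _; exact: sqr_ge0.
Qed.

Lemma open_eball N (r : R) : open (@eball R N r).
Proof.
rewrite (_ : eball r = @enorm R N @^-1` [set t | t < r])//.
by apply: open_comp; [move=> x _; exact: continuous_enorm|exact: open_lt].
Qed.

Lemma measurable_eball N (r : R) : measurable (@eball R N r).
Proof. by apply: open_measurable_rV; exact: open_eball. Qed.

Lemma measurable_annulus N (s t : R) : measurable (@annulus R N s t).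
Proof. by apply: measurableD; exact: measurable_eball. Qed.

(** A ball of the sup norm. Its product structure gives compactness and finite measure, so supports
    and Euclidean balls are enclosed in cubes. *)
Definition cube N (r : R) : set 'rV[R]_N := [set x | forall i, `|x 0 i| <= r].

Lemma notin_cube N (r : R) (x : 'rV[R]_N) : ~ cube r x -> exists i, r < `|x 0 i|.
Proof.
by move=> xr; apply/not_existsP => h; apply: xr => i; rewrite leNgt; apply/negP/h.
Qed.

Lemma measurable_cube N (r : R) : measurable (@cube N r).
Proof.
rewrite (_ : @cube N r = \bigcap_(i in [set: 'I_N])
    ((fun x : 'rV[R]_N => x 0 i : measurableTypeR R) @^-1` `[- r, r])).
  apply: fin_bigcap_measurable => // i _; rewrite -[X in measurable X]setTI.
  by apply: measurable_coord_rV.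
apply/seteqP; split => x /= xr i.
  by move=> _; rewrite /= in_itv /= -ler_norml.
by have := xr i I; rewrite /= in_itv /= -ler_norml.
Qed.

Lemma lebesgue_cube N (r : R) : (lebesgue_rV (@cube N r) < +oo)%E.
Proof.
elim: N => [|N IH].
  by rewrite /= diracE; case: (_ \in _); rewrite ltry.
rewrite /= /pushforward.
rewrite (_ : _ @^-1` _ = `[- r, r]%classic `*` @cube N r).
  rewrite product_measure1E//; last exact: measurable_cube.
  rewrite [X in (X * _)%E](_ : _ = lebesgue_measure `[- r, r]%classic)//.
  rewrite lebesgue_measure_itv /=; case: ifPn => [|_]; last by rewrite mul0e ltry.
  by rewrite lte_fin => rr; rewrite lte_mul_pinfty//= lee_fin; lra.
apply/seteqP; split => [[x y]|[x y]] /=.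
  move=> xy; split; last by move=> i; have := xy (lift ord0 i); rewrite cons_rV_lift.
  by have := xy ord0; rewrite cons_rV0 in_itv /= -ler_norml.
move=> [+ xy] i; rewrite in_itv /= -ler_norml => xr.
by case: (unliftP ord0 i) => [j|] ->; rewrite ?cons_rV0 ?cons_rV_lift.
Qed.

Lemma lebesgue_eball_fin N (r : R) : (lebesgue_rV (@eball R N r) < +oo)%E.
Proof.
apply: le_lt_trans (lebesgue_cube N r); apply: le_measure; rewrite ?inE.
- exact: measurable_eball.
- exact: measurable_cube.
- by move=> x xr i; apply: (le_trans (coord_le_enorm _ _)); exact: ltW.
Qed.

Lemma lebesgue_rVT_gt0 N : (0 < lebesgue_rV [set: 'rV[R]_N])%E.
Proof.
elim: N => [|N IH]; first by rewrite /= diracE in_setT lte01.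
rewrite /= /pushforward preimage_setT -setXTT product_measure1E//.
rewrite mule_gt0// [ltRHS](_ : _ = @lebesgue_measure R setT)//.
by rewrite -set_itvNyy lebesgue_measure_itv /= ltry.
Qed.

Definition unit_ball_volume N : R := fine (lebesgue_rV (@eball R N 1)).

Lemma unit_ball_volumeE N :
  lebesgue_rV (@eball R N 1) = (unit_ball_volume N)%:E.
Proof. by rewrite fineK// ge0_fin_numE// lebesgue_eball_fin. Qed.

Lemma lebesgue_eball_gt N (r : R) : 0 < r ->
  lebesgue_rV (@eball R N r) = (unit_ball_volume N * r ^+ N)%:E.
Proof.
move=> r0; have r1 : 0 < r^-1 by rewrite invr_gt0.
rewrite EFinM -unit_ball_volumeE muleC.
have := lebesgue_rV_affine 0 r1 (@measurable_eball N 1).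
rewrite exprVn invrK => <-; congr (lebesgue_rV _); apply/seteqP.
split=> x /=; rewrite /eball /= addr0 enormZ gtr0_norm// mulrC ltr_pdivrMr ?mul1r//.
Qed.

(** By scaling, a null unit ball would make every ball null; countably many balls cover the space,
    whose measure is positive. *)
Lemma unit_ball_volume_gt0 N : 0 < unit_ball_volume N.
Proof.
rewrite lt0r fine_ge0 ?andbT//; apply/eqP => w0.
have := lebesgue_rVT_gt0 N; rewrite (_ : setT = \bigcup_k eball (k.+1%:R : R)).
  rewrite lt_neqAle => /andP[/eqP + _]; apply; apply/esym/eqP.
  rewrite -measure_le0; apply: le_trans (measure_sigma_subadditive _ _ _ (@subset_refl _ _)) _.
  - by move=> k; exact: measurable_eball.
  - by apply: bigcup_measurable => k _; exact: measurable_eball.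
  rewrite eseries0// => k _ _; apply: (eq_trans (@lebesgue_eball_gt N _ _)) => //.
  by rewrite [unit_ball_volume N]w0 mul0r.
apply/esym; rewrite -subTset => x _; exists (Num.truncn (enorm x)) => //.
exact: truncnS_gt.
Qed.

End enorm.

Section pushforward.
Context {R : realType} (N : nat) (N0 : (0 < N)%N).
Notation leb := (@lebesgue_measure R).
Notation lebN := (@lebesgue_rV R N).
Notation omega := (@unit_ball_volume R N).

Definition enormN (x : 'rV[R]_N) : measurableTypeR R := enorm x ^+ N.

Lemma enormN_ge0 (x : 'rV[R]_N) : 0 <= enormN x.
Proof. by rewrite exprn_ge0// enorm_ge0. Qed.

Lemma measurable_enormN : measurable_fun setT enormN.
Proof. by apply: measurable_funX; exact: measurable_enorm. Qed.

Lemma continuous_enormN : continuous (enormN : 'rV[R]_N -> R).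
Proof.
move=> x; apply: (@continuous_comp _ _ _ (@enorm R N) (fun t => t ^+ N)).
  exact: continuous_enorm.
exact: exprn_continuous.
Qed.

Lemma root_exprn (c : R) : 0 <= c -> (c `^ N%:R^-1) ^+ N = c.
Proof.
move=> c0; rewrite -powR_mulrn ?powR_ge0// -powRrM mulVf ?powRr1//.
by rewrite pnatr_eq0 -lt0n.
Qed.

Lemma exprn_root (x : R) : 0 <= x -> (x ^+ N) `^ N%:R^-1 = x.
Proof.
move=> x0; apply/eqP; rewrite -(@eqrXn2 _ N) ?powR_ge0//.
by rewrite root_exprn// exprn_ge0.
Qed.

Lemma lebesgue_enormN_lt (c : R) : 0 <= c ->
  lebN (enormN @^-1` `]-oo, c[) = (omega * c)%:E.
Proof.
rewrite le_eqVlt => /predU1P[<-|c0].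
  rewrite mulr0 (_ : _ @^-1` _ = set0) ?measure0//.
  apply/seteqP; split => x //=; rewrite in_itv /= => xc.
  by have := enormN_ge0 x; rewrite leNgt xc.
rewrite -[in RHS](root_exprn (ltW c0)) -lebesgue_eball_gt ?powR_gt0//.
congr (lebesgue_rV _); apply/seteqP; split => x /=; rewrite in_itv /= /eball /enormN /=.
  by rewrite -{1}(root_exprn (ltW c0)) ltr_pXn2r// ?nnegrE ?enorm_ge0 ?powR_ge0.
by rewrite -[X in _ -> _ < X](root_exprn (ltW c0)) ltr_pXn2r// ?nnegrE ?enorm_ge0 ?powR_ge0.
Qed.

Lemma measurable_enormN_pre (A : set (measurableTypeR R)) : measurable A ->
  measurable (enormN @^-1` A).
Proof. by move=> mA; rewrite -[X in measurable X]setTI; exact: measurable_enormN. Qed.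

Lemma lebesgue_enormN_le (c : R) : 0 <= c ->
  lebN (enormN @^-1` `]-oo, c]) = (omega * c)%:E.
Proof.
move=> c0; have w0 := @unit_ball_volume_gt0 R N.
apply/eqP; rewrite eq_le; apply/andP; split.
  apply/lee_addgt0Pr => e e0.
  have ew : 0 <= c + e / omega by rewrite addr_ge0// divr_ge0// ltW.
  rewrite -EFinD (_ : _ + e = omega * (c + e / omega)); last first.
    by rewrite mulrDr mulrCA divff ?mulr1// gt_eqF.
  rewrite -lebesgue_enormN_lt//; apply: le_measure; rewrite ?inE.
  - exact: measurable_enormN_pre.
  - exact: measurable_enormN_pre.
  - by move=> x /=; rewrite !in_itv /= => /le_lt_trans; apply; rewrite ltrDl divr_gt0.
rewrite -lebesgue_enormN_lt//; apply: le_measure; rewrite ?inE.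
- exact: measurable_enormN_pre.
- exact: measurable_enormN_pre.
- by move=> x /=; rewrite !in_itv /= => /ltW.
Qed.

Lemma lebesgue_enormN (A : set (measurableTypeR R)) : measurable A ->
  lebN (enormN @^-1` A) = (omega%:E * leb (A `&` `[0%R, +oo[))%E.
Proof.
move=> mA; have w0 := @unit_ball_volume_gt0 R N.
have w1 : 0 <= omega^-1 by rewrite invr_ge0 ltW.
pose nu : {measure set (measurableTypeR R) -> \bar R} := pushforward lebN enormN.
(* The image measure does not charge the negative reals, while uniqueness concerns measures on the
   whole line: adding Lebesgue measure on []-oo, 0[] makes [mu] agree with [leb] on every []c,
   d]]. *)
pose mneg : {measure set (measurableTypeR R) -> \bar R} :=
  mrestr leb (@measurable_itv R `]-oo, 0%R[).
pose mu : {measure set (measurableTypeR R) -> \bar R} :=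
  measure_add (mscale (NngNum w1) (nu measurable_enormN)) mneg.
have muE B : mu B = (omega^-1%:E * lebN (enormN @^-1` B) + leb (B `&` `]-oo, 0%R[))%E.
  exact: measure_addE.
have lebmu : forall B, measurable B -> leb B = mu B.
  apply: lebesgue_measure_unique => _ [[c d] _ <-] /=.
  rewrite muE; have [cd|dc] := ltP c d; last first.
    by rewrite set_itv_ge ?bnd_simp -?leNgt// preimage_set0 set0I !measure0 mule0 adde0.
  have [c0|c0] := leP 0 c.
    rewrite (_ : enormN @^-1` _ = (enormN @^-1` `]-oo, d]) `\` (enormN @^-1` `]-oo, c])); last first.
      apply/seteqP; split => x /=; rewrite !in_itv /=.
        by move=> /andP[cx ->]; split => //; apply/negP; rewrite -ltNge.
      by move=> [-> /negP]; rewrite -ltNge => ->.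
    rewrite measureD/=; [|exact: measurable_enormN_pre..|]; last first.
      by rewrite lebesgue_enormN_le ?ltry//; lra.
    rewrite (_ : _ `&` _ = enormN @^-1` `]-oo, c]); last first.
      apply/seteqP; split => x /=; rewrite !in_itv /=; first by case.
      by move=> xc; split => //; exact: (le_trans xc (ltW cd)).
    rewrite !lebesgue_enormN_le//; last by lra.
    rewrite (_ : `]c, d] `&` _ = set0); last first.
      by apply/seteqP; split => x //= []; rewrite !in_itv /= => /andP[]; lra.
    rewrite measure0 adde0 lebesgue_measure_itv /= lte_fin cd -!EFinB -EFinM.
    by congr EFin; rewrite -mulrBr mulKf// gt_eqF.
  have [d0|d0] := leP 0 d.
    rewrite (_ : enormN @^-1` _ = enormN @^-1` `]-oo, d]); last first.
      apply/seteqP; split => x /=; rewrite !in_itv /=; first by move=> /andP[].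
      by move=> ->; rewrite andbT (lt_le_trans c0)// enormN_ge0.
    rewrite lebesgue_enormN_le// (_ : _ `&` _ = `]c, 0[%classic); last first.
      apply/seteqP; split => x /=; rewrite !in_itv /=; first by move=> [/andP[-> _] ->].
      by move=> /andP[-> x0]; split => //; rewrite (le_trans (ltW x0)).
    rewrite !lebesgue_measure_itv /= !lte_fin cd c0 -EFinM -!EFinB -EFinD.
    by congr EFin; rewrite mulKf ?gt_eqF// sub0r.
  rewrite (_ : enormN @^-1` _ = set0); last first.
    apply/seteqP; split => x //=; rewrite in_itv /= => /andP[_ xd].
    by have := le_lt_trans xd d0; rewrite ltNge enormN_ge0.
  rewrite measure0 mule0 add0e; congr (leb _).
  apply/seteqP; split => x /=; rewrite !in_itv /=; last by move=> [].
  by move=> /andP[-> xd]; split => //; exact: le_lt_trans d0.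
have -> : enormN @^-1` A = enormN @^-1` (A `&` `[0%R, +oo[).
  apply/seteqP; split => x /=; last by move=> [].
  by move=> Ax; split => //; rewrite in_itv /= enormN_ge0.
rewrite lebmu; last exact: measurableI.
rewrite muE -setIA (_ : `[0%R, +oo[ `&` _ = set0); last first.
  by apply/seteqP; split => x //= []; rewrite !in_itv /= andbT => ?; rewrite ltNge => /negP.
rewrite setI0 measure0 adde0 muleA -EFinM divff ?gt_eqF// mul1e.
by [].
Qed.

Lemma ge0_integral_enormN (g : measurableTypeR R -> \bar R) :
  measurable_fun setT g -> (forall t, 0 <= g t)%E ->
  (\int[lebN]_x g (enormN x) = omega%:E * \int[leb]_(t in `[0%R, +oo[) g t)%E.
Proof.
move=> mg g0; have w0 := ltW (@unit_ball_volume_gt0 R N).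
pose D : set (measurableTypeR R) := `[0%R, +oo[%classic.
have mD : measurable D by exact: measurable_itv.
have := @ge0_integral_pushforward _ _ _ _ R _ measurable_enormN lebN D g mD.
rewrite (_ : enormN @^-1` _ = setT); last first.
  by apply/seteqP; split => x //= _; rewrite /D /= in_itv /= enormN_ge0.
rewrite /comp => <-//; last exact: measurable_funTS.
rewrite (@eq_measure_integral _ _ R D (mscale (NngNum w0) leb)).
- by rewrite ge0_integral_mscale//; exact: measurable_funTS.
- exact: measurable_enormN.
move=> ? A mA /setIidl A0.
by have := lebesgue_enormN mA; rewrite -/D A0.
Qed.

End pushforward.

(** * Integration by parts *)

Section integral_partial.
Context {R : realType} {N : nat}.
Notation lebN := (@lebesgue_rV R N).

Lemma compact_cube (r : R) : compact (@cube R N r).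
Proof.
rewrite (_ : @cube R N r = [set v | forall i, `[- r, r]%classic (v ord0 i)]).
  by apply: (@rV_compact R N (fun=> `[- r, r]%classic)) => i; exact: segment_compact.
by apply/seteqP; split => x /= xr i; have := xr i; rewrite /= in_itv /= ler_norml.
Qed.

Lemma continuous_bounded_cube (f : 'rV[R]_N -> R) (r : R) : continuous f ->
  exists2 M, 0 <= M & forall x, cube r x -> `|f x| <= M.
Proof.
move=> cf.
have /compact_bounded[M [_ fM]] : compact (f @` @cube R N r).
  apply: continuous_compact; last exact: compact_cube.
  exact: continuous_subspaceT.
exists (`|M| + 1) => [|x xr]; first by rewrite addr_ge0.
by apply: (fM (`|M| + 1)); [rewrite (le_lt_trans (ler_norm M))// ltrDl|exists x].
Qed.

Lemma integrable_cube (f : 'rV[R]_N -> R) (r M : R) :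
  measurable_fun setT (f : _ -> measurableTypeR R) ->
  (forall x, `|f x| <= M) -> (forall x, ~ cube r x -> f x = 0) ->
  lebN.-integrable setT (EFin \o f).
Proof.
move=> mf fM f0.
have -> : EFin \o f = (EFin \o f) \_ (cube r).
  apply/funext => x; rewrite patchE; case: ifPn => //.
  by rewrite notin_setE => /f0 /= ->.
apply/(integrable_mkcond _ _).1; first exact: measurable_cube.
apply: measurable_bounded_integrable.
- exact: measurable_cube.
- exact: lebesgue_cube.
- exact: measurable_funTS.
- exists M; split; first exact: num_real.
  by move=> y My x /= _; exact: le_trans (fM x) (ltW My).
Qed.

Lemma integrable_continuous_cube (f : 'rV[R]_N -> R) (r : R) : continuous f ->
  (forall x, ~ cube r x -> f x = 0) -> lebN.-integrable setT (EFin \o f).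
Proof.
move=> cf f0; have [M M0 fM] := continuous_bounded_cube r cf.
apply: (@integrable_cube _ r M) => //; first exact: continuous_measurable_rV.
by move=> x; have [/fM//|/f0 ->] := pselect (cube r x); rewrite normr0.
Qed.

Lemma integral_translate (f : 'rV[R]_N -> \bar R) (b : 'rV[R]_N) :
  measurable_fun setT f -> lebN.-integrable setT f ->
  lebN.-integrable setT (fun x => f (x + b)) /\
  (\int[lebN]_x f (x + b)%R = \int[lebN]_x f x)%E.
Proof.
move=> mf fi.
have mT : measurable_fun setT (fun x : 'rV[R]_N => x + b).
  by have := measurable_affine_rV 1 b; under eq_fun do rewrite scale1r.
have pT (A : set 'rV[R]_N) : measurable A -> pushforward lebN (fun x => x + b) A = lebN A.
  move=> mA; have := lebesgue_rV_affine b ltr01 mA.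
  rewrite expr1n invr1 mul1e => <-.
  by rewrite /pushforward /preimage; under [in RHS]eq_set do rewrite scale1r.
have fbi : lebN.-integrable setT (fun x => f (x + b)).
  apply/integrableP; split; first exact: (measurableT_comp mf mT).
  move/integrableP : fi => [_]; apply: le_lt_trans.
  have := @ge0_integral_pushforward _ _ _ _ R _ mT lebN setT (abse \o f) measurableT.
  rewrite preimage_setT /comp => <- //; last exact: measurableT_comp.
  by rewrite (@eq_measure_integral _ _ R setT lebN)// => A mA _; exact: pT.
split => //.
have := @integral_pushforward _ _ _ _ R _ mT lebN setT f mf.
rewrite preimage_setT /comp => <- //.
by rewrite (@eq_measure_integral _ _ R setT lebN)// => A mA _; exact: pT.
Qed.

Lemma is_derive_line (f : 'rV[R]_N -> R) (v x : 'rV[R]_N) (t : R) :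
  derivable f (t *: v + x) v ->
  is_derive t 1 (fun h : R => f (h *: v + x)) ('D_v f (t *: v + x)).
Proof.
have E : (fun h : R => h^-1 *: (((fun h : R => f (h *: v + x)) \o shift t) (h *: 1) -
     f (t *: v + x))) =
    (fun h => h^-1 *: ((f \o shift (t *: v + x)) (h *: v) - f (t *: v + x))).
  by apply/funext => h /=; rewrite [h%:A]mulr1 scalerDl addrA.
by move=> df; apply: DeriveDef; rewrite /derivable /derive E.
Qed.

(** Mean value theorem along the segment from [x] to [h *: v + x]; it provides the domination needed
    in [integral_partial]. *)
Lemma diff_quotient_le (f : 'rV[R]_N -> R) (v x : 'rV[R]_N) (h M : R) : 0 < h ->
  (forall y, derivable f y v) ->
  (forall t, 0 <= t <= h -> `|'D_v f (t *: v + x)| <= M) ->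
  `|h^-1 * (f (h *: v + x) - f x)| <= M.
Proof.
move=> h0 df fM.
have cl : continuous (fun h : R => f (h *: v + x)).
  move=> t; apply: differentiable_continuous; apply/derivable1_diffP.
  by have [] := is_derive_line (df (t *: v + x)).
have [||c] := @MVT_segment R (fun h => f (h *: v + x)) (fun t => 'D_v f (t *: v + x)) _ _ (ltW h0).
  by move=> t _; exact: is_derive_line.
  exact: continuous_subspaceT.
rewrite in_itv /= => ch; rewrite scale0r add0r subr0 => ->.
by rewrite mulrCA mulVf ?gt_eqF// mulr1 fM.
Qed.

(* The difference quotients of f have integral 0 by translation invariance; pass
   to the limit by dominated convergence. *)
Lemma integral_partial (f : 'rV[R]_N -> R) (i : 'I_N) (r : R) :
  continuous f -> (forall x, derivable f x (delta_mx 0 i)) ->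
  continuous (partial i f) -> (forall x, ~ cube r x -> f x = 0) ->
  (\int[lebN]_x (partial i f x)%:E = 0)%E.
Proof.
move=> cf df cdf f0.
set e := delta_mx 0 i in df cdf *.
have fi := integrable_continuous_cube cf f0.
have mf : measurable_fun setT (EFin \o f).
  by apply/measurable_EFinP; exact: continuous_measurable_rV.
pose h (n : nat) : R := n.+1%:R^-1.
have h_gt0 n : 0 < h n by rewrite /h invr_gt0.
pose g n (x : 'rV[R]_N) : \bar R := ((h n)^-1 * (f (h n *: e + x) - f x))%:E.
have gi n : lebN.-integrable setT (g n) /\ (\int[lebN]_x g n x = 0)%E.
  have [fhi fhE] := integral_translate (h n *: e) mf fi.
  pose d : 'rV[R]_N -> \bar R := ((fun x => (EFin \o f) (x + h n *: e)%R) \- (EFin \o f))%E.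
  have -> : g n = (fun x => ((h n)^-1%:E * d x)%E).
    by apply/funext => x; rewrite /g EFinM EFinB (addrC _ x).
  have di : lebN.-integrable setT d by exact: integrableB.
  split; first exact: (integrableZl measurableT _ di).
  rewrite integralZl// integralB// fhE subee ?mule0//.
  exact: integrable_fin_num.
(* Since [h n <= 1], the quotients vanish outside [cube (r + 1)], and from a point of that cube the
   segment to its translate stays in [cube (r + 2)]. *)
have [M M0 dfM] := continuous_bounded_cube (r + 2) cdf.
have h_le1 n : h n <= 1 by rewrite /h invf_le1// ler1n.
have enear x y (s t : R) j : 0 <= t <= 1 -> y = t *: e + x -> `|x 0 j| <= s -> `|y 0 j| <= s + 1.
  move=> /andP[t0 t1] -> xs; rewrite !mxE; apply: le_trans (ler_normD _ _) _.
  rewrite addrC lerD// eqxx normrM ger0_norm//.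
  by case: (j == i); rewrite ?normr1 ?normr0 ?mulr1 ?mulr0.
have gM n x : (`|g n x| <= (M * \1_(cube (r + 1)) x)%:E)%E.
  rewrite lee_fin indicE; have [xr|xr] := pselect (cube (r + 1) x).
    rewrite mem_set// mulr1; apply: diff_quotient_le => // t /andP[t0 th].
    apply: dfM => j; rewrite (_ : r + 2 = (r + 1) + 1); last by lra.
    by apply: (enear x _ _ t) => //; rewrite t0 (le_trans th).
  rewrite memNset// mulr0 (f0 x); last first.
    by apply: contra_not xr => xr j; rewrite (le_trans (xr j))// lerDl.
  rewrite f0 ?subr0 ?mulr0 ?normr0// => /= xhr; apply: xr => j.
  rewrite -lerBlDr; apply: contraTT (xhr j); rewrite -!ltNge => xj.
  rewrite !mxE eqxx /=.
  have := lerB_normD (x 0 j) (h n * (j == i)%:R).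
  have : `|h n * (j == i)%:R| <= 1.
    by case: (j == i); rewrite ?mulr1 ?mulr0 ?normr0// gtr0_norm.
  rewrite [_ + x 0 j]addrC.
  by move: xj; set b := `|x 0 j|; set a := `|h n * _|; set c := `|_|; lra.
have [] := @dominated_convergence _ _ R lebN setT measurableT g
  (fun x => (partial i f x)%:E) (fun x => (M * \1_(cube (r + 1)) x)%:E).
- by move=> n; have [/integrableP[]] := gi n.
- by apply/measurable_EFinP; exact: continuous_measurable_rV.
- apply/aeW => x _; apply/fine_cvgP; split; first by apply: nearW.
  have /cvg_ex[l fl] := df x.
  have dE : partial i f x = l by exact: cvg_lim fl.
  rewrite dE.
  have /cvgr_dnbhsP := fl; apply; split; last exact: cvg_harmonic.
  by move=> n; rewrite gt_eqF.
- apply: (@integrable_cube _ (r + 1) M).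
  + by apply: measurable_funM => //; apply: measurable_indic; exact: measurable_cube.
  + by move=> x; rewrite indicE; case: (_ \in _); rewrite ?mulr1 ?mulr0 ?normr0// ger0_norm.
  + by move=> x xr; rewrite indicE memNset// mulr0.
- by apply/aeW => x n _; exact: gM.
move=> _ _; rewrite (_ : [sequence _]_n = cst 0%E); last first.
  by apply/funext => n /=; have [] := gi n.
move=> /cvg_lim <- //; first by rewrite lim_cst.
Qed.

End integral_partial.

(** * Radial cut-offs *)

Section step.
Context {R : realType}.
Implicit Types s : R.

(* A C^1 step from 0 to 1 across [0, 2] and its derivative, obtained as second
   differences of max(s, 0)^2 / 2 and of max(s, 0). *)
Definition pos2 s : R := Num.max s 0 ^+ 2.
Definition step s : R := (pos2 s - 2 * pos2 (s - 1) + pos2 (s - 2)) / 2.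
Definition tent s : R := Num.max s 0 - 2 * Num.max (s - 1) 0 + Num.max (s - 2) 0.

Lemma nbhs_gt (x a : R) : a < x -> \forall y \near x, a < y.
Proof. by move=> ax; exact: (cvgr_gt x cvg_id). Qed.

Lemma continuous_max0 : continuous (fun s => Num.max s 0).
Proof.
by move=> s; apply: (@continuous_max R R id (cst 0) s); [exact: cvg_id|exact: cvg_cst].
Qed.

Lemma is_derive_pos2 s : is_derive s 1 pos2 (2 * Num.max s 0).
Proof.
have [s0|s0|->] := ltgtP s 0.
- rewrite mulr0; apply: (@near_eq_is_derive _ _ _ (cst 0)).
  near=> t; rewrite /pos2 (max_idPr _) ?expr0n// ltW//.
  by near: t; exact: lt_nbhsl.
- apply: (@near_eq_is_derive R R^o R^o (fun t : R => t ^+ 2)).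
    near=> t; rewrite /pos2 (max_idPl _)// ltW//.
    by near: t; exact: nbhs_gt.
  split; first exact: exprn_derivable.
  by rewrite exp_derive expr1 scaler1.
(* At the junction [s = 0] the difference quotient is [max h 0] itself, which tends to 0. *)
have E : (fun h : R => h^-1 *: ((pos2 \o shift 0) (h *: 1) - pos2 0)) =
    (fun h : R => Num.max h 0).
  apply/funext => h /=; rewrite [h%:A]mulr1 addr0 /pos2 maxxx expr0n subr0.
  rewrite /GRing.scale /=; have [h0|h0] := leP h 0; first by rewrite expr0n mulr0.
  by rewrite expr2 mulKf// gt_eqF.
have c : (fun h : R => Num.max h 0) @ 0^' --> (0 : R).
  apply: cvg_within_filter.
  by have := @continuous_max0 0; rewrite /continuous_at maxxx.
rewrite mulr0; apply: DeriveDef; rewrite /derivable /derive E; last exact: cvg_lim c.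
by apply/cvg_ex; exists 0.
Unshelve. all: by end_near. Qed.

Lemma continuous_tent : continuous tent.
Proof.
move=> s; have c (a : R) : {for s, continuous (fun s => Num.max (s - a) 0)}.
  apply: (@continuous_comp _ _ _ (fun t => t - a) (fun t => Num.max t 0)).
    by apply: continuousB; [exact: cvg_id|exact: cvg_cst].
  exact: continuous_max0.
rewrite /continuous_at /tent; apply: cvgD; last exact: c.
by apply: cvgB; [exact: continuous_max0|apply: cvgM; [exact: cvg_cst|exact: c]].
Qed.

Lemma is_derive_step s : is_derive s 1 step (tent s).
Proof.
have d (a : R) : is_derive s 1 (fun t => pos2 (t - a)) (2 * Num.max (s - a) 0).
  have dB := is_deriveB (is_derive_id s 1) (is_derive_cst a s 1).
  apply: (is_derive_eq (@is_derive1_comp _ pos2 (fun t => t - a) s _ _ (is_derive_pos2 _) dB)).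
  by rewrite subr0 mulr1.
have -> : step = 2^-1 *: (pos2 - 2 *: (fun t => pos2 (t - 1)) + (fun t => pos2 (t - 2))).
  by apply/funext => t; rewrite /step mulrC.
have dS := is_deriveD (is_deriveB (is_derive_pos2 s) (is_deriveZ 2 (d 1))) (d 2).
apply: (is_derive_eq (is_deriveZ 2^-1 dS)).
by rewrite /GRing.scale /= /tent; field.
Qed.

Lemma step_le0 s : s <= 0 -> step s = 0.
Proof.
move=> s0; rewrite /step /pos2 !(max_idPr _); first by field.
- by lra.
- by lra.
- by lra.
Qed.

Lemma step_ge2 s : 2 <= s -> step s = 1.
Proof.
move=> s0; rewrite /step /pos2 !(max_idPl _); first by field.
- by lra.
- by lra.
- by lra.
Qed.

Lemma step_itv s : 0 <= step s <= 1.
Proof.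
rewrite /step /pos2; have [?|?] := leP s 0; have [?|?] := leP (s - 1) 0;
  have [?|?] := leP (s - 2) 0; apply/andP; split; nra.
Qed.

Lemma tent_itv s : 0 <= tent s <= 1.
Proof.
rewrite /tent; have [?|?] := leP s 0; have [?|?] := leP (s - 1) 0;
  have [?|?] := leP (s - 2) 0; apply/andP; split; lra.
Qed.

Lemma tent_le0 s : s <= 0 -> tent s = 0.
Proof.
move=> ?; rewrite /tent; have [?|?] := leP s 0; have [?|?] := leP (s - 1) 0;
  have [?|?] := leP (s - 2) 0; lra.
Qed.

Lemma tent_ge2 s : 2 <= s -> tent s = 0.
Proof.
move=> ?; rewrite /tent; have [?|?] := leP s 0; have [?|?] := leP (s - 1) 0;
  have [?|?] := leP (s - 2) 0; lra.
Qed.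

End step.

Section radial.
Context {R : realType} {N : nat} (N0 : (0 < N)%N).

Lemma differentiable_sqnorm (x : 'rV[R]_N) : differentiable (@sqnorm R N) x.
Proof.
rewrite (_ : @sqnorm R N = \sum_(i < N) (fun y : 'rV[R]_N => y 0 i ^+ 2)).
  apply: differentiable_sum => i.
  apply: (@differentiable_comp _ _ _ _ (fun y : 'rV[R]_N => y 0 i) (fun t : R => t ^+ 2)).
    exact: differentiable_coord.
  by apply/derivable1_diffP; exact: exprn_derivable.
by apply/funext => y; rewrite fct_sumE.
Qed.

Lemma derive_sqnorm (x : 'rV[R]_N) (i : 'I_N) :
  'D_(delta_mx 0 i) (@sqnorm R N) x = 2 * x 0 i.
Proof.
have : derivable (@sqnorm R N) x (delta_mx 0 i).
  by apply: diff_derivable; exact: differentiable_sqnorm.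
move=> /cvg_ex[l fl].
rewrite /derive (cvg_lim _ fl)//; apply: (cvg_unique _ fl) => //.
apply: (@cvg_trans _ ((fun h : R => 2 * x 0 i + h) @ 0^')).
  apply: near_eq_cvg; near=> h; have h0 : h != 0 by near: h; exact: nbhs_dnbhs_neq.
  rewrite /= /sqnorm -sumrB (bigD1 i)//= big1 ?addr0.
    rewrite !mxE !eqxx /GRing.scale /=.
    by field.
  by move=> j ji; rewrite !mxE eqxx (negbTE ji) mulr0 add0r subrr.
apply: cvg_within_filter.
have c : 2 * x 0 i + h @[h --> (0 : R)] --> 2 * x 0 i + 0.
  by apply: cvgD; [exact: cvg_cst|exact: cvg_id].
by move: c; rewrite addr0; exact.
Unshelve. all: by end_near. Qed.

(* H vanishes near 0, so that H (|x|^N) does not see the singularity of the norm at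
   the origin. *)
Variables (H h : R -> R) (sigma : R).
Hypotheses (sigma_gt0 : 0 < sigma)
  (dH : forall s : R, 0 < s -> is_derive s 1 H (h s))
  (ch : forall s : R, 0 < s -> {for s, continuous h})
  (H0 : forall s, s < sigma -> H s = 0) (h0 : forall s, s < sigma -> h s = 0).

(** [|x|^N] is factored through the squared norm, a polynomial. The only singularity left is that of
    [P] at 0, and [H \o P] vanishes near every [t <= 0]; [g] is the derivative of [H \o P] on the
    whole line. *)
Let P (t : R) : R := Num.sqrt t ^+ N.
Let g (t : R) : R := h (P t) * (N%:R * P t / (2 * t)).

Let continuous_P : continuous P.
Proof.
move=> t; apply: (@continuous_comp _ _ _ Num.sqrt (fun t => t ^+ N)).
  exact: sqrt_continuous.
exact: exprn_continuous.
Qed.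

Let P_gt0 (t : R) : 0 < t -> 0 < P t.
Proof. by move=> t0; rewrite exprn_gt0// sqrtr_gt0. Qed.

Let P_le0 (t : R) : t <= 0 -> P t = 0.
Proof. by move=> t0; rewrite /P ler0_sqrtr// expr0n gtn_eqF. Qed.

Let is_derive_P (t : R) : 0 < t -> is_derive t 1 P (N%:R * P t / (2 * t)).
Proof.
move=> t0; have sN : is_derive (Num.sqrt t) 1 (fun s : R => s ^+ N) (N%:R * Num.sqrt t ^+ N.-1).
  split; first exact: exprn_derivable.
  by rewrite exp_derive scaler1.
apply: (is_derive_eq (@is_derive1_comp _ _ _ _ _ _ sN (is_derive1_sqrt t0))).
have s0 : Num.sqrt t != 0 by rewrite gt_eqF// sqrtr_gt0.
have -> : P t = Num.sqrt t ^+ N.-1 * Num.sqrt t by rewrite -exprSr prednK.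
have := sqr_sqrtr (ltW t0); move: (Num.sqrt t) s0 => s s0 <-.
by field.
Qed.

Let near_P_lt (t : R) : t <= 0 -> \forall u \near t, P u < sigma.
Proof.
move=> t0; have := @continuous_P t; rewrite /continuous_at P_le0// => cP.
exact: (cvgr_lt _ cP).
Qed.

Let is_derive_HP (t : R) : is_derive t 1 (H \o P) (g t).
Proof.
have [t0|t0] := ltP 0 t.
  exact: (@is_derive1_comp _ H P t _ _ (dH (P_gt0 t0)) (is_derive_P t0)).
rewrite /g P_le0// h0// mul0r; apply: (@near_eq_is_derive _ _ _ (cst 0)).
by apply: filterS (near_P_lt t0) => u Pu; rewrite /= H0.
Qed.

Let continuous_g : continuous g.
Proof.
move=> t; have [t0|t0] := ltP 0 t.
  rewrite /continuous_at /g; apply: cvgM.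
    by apply: (@continuous_comp _ _ _ P h); [exact: continuous_P|apply: ch; exact: P_gt0].
  apply: cvgM; first by apply: cvgM; [exact: cvg_cst|exact: continuous_P].
  apply: cvgV; first by rewrite mulf_neq0// gt_eqF.
  by apply: cvgM; [exact: cvg_cst|exact: cvg_id].
apply: (@near_cst_continuous _ _ 0).
by apply: filterS (near_P_lt t0) => u Pu; rewrite /g h0// mul0r.
Qed.

Let HE : (fun x : 'rV[R]_N => H (enormN x)) = (H \o P) \o @sqnorm R N.
Proof. by []. Qed.

Lemma differentiable_radial (x : 'rV[R]_N) : differentiable (fun x => H (enormN x)) x.
Proof.
rewrite HE; apply: differentiable_comp; first exact: differentiable_sqnorm.
by apply/derivable1_diffP; have [] := is_derive_HP (sqnorm x).
Qed.

Lemma partial_radial (i : 'I_N) (x : 'rV[R]_N) :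
  partial i (fun x => H (enormN x)) x = N%:R * h (enormN x) * enormN x / sqnorm x * x 0 i.
Proof.
rewrite /partial HE deriveE; last exact: differentiable_radial.
have dg : differentiable (H \o P) (sqnorm x).
  by apply/derivable1_diffP; have [] := is_derive_HP (sqnorm x).
rewrite diff_comp//; last exact: differentiable_sqnorm.
rewrite /= -[in X in 'd _ _ X]deriveE; last exact: differentiable_sqnorm.
rewrite derive_sqnorm -[X in 'd _ _ X]mulr1.
rewrite [LHS]linearZ -deriveE//; have [_ ->] := is_derive_HP (sqnorm x).
rewrite /g /GRing.scale /= -/(enormN x).
(* At the origin both sides are 0, because [0^-1 = 0]. *)
have [->|q0] := eqVneq (sqnorm x) 0.
  by rewrite mulr0 invr0 !(mulr0, mul0r) scaler0.
rewrite -[LHS]/(_ * _).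
by rewrite /enormN /enorm -/(sqnorm x) -/(P (sqnorm x)); field.
Qed.

Lemma continuous_partial_radial (i : 'I_N) :
  continuous (partial i (fun x : 'rV[R]_N => H (enormN x))).
Proof.
rewrite (_ : partial _ _ = fun x : 'rV[R]_N => 2 * x 0 i * g (sqnorm x)); last first.
  apply/funext => x; rewrite partial_radial /g.
  have [->|q0] := eqVneq (sqnorm x) 0; first by rewrite mulr0 invr0 !(mulr0, mul0r).
  by rewrite /enormN /enorm -/(sqnorm x) -/(P (sqnorm x)); field.
move=> x; apply: (@continuousM _ _ (fun y : 'rV[R]_N => 2 * y 0 i) (fun y => g (sqnorm y))).
  apply: (@continuousM _ _ (cst 2) (fun y : 'rV[R]_N => y 0 i)); first exact: cst_continuous.
  exact: coord_continuous.
by apply: (@continuous_comp _ _ _ (@sqnorm R N) g); [exact: continuous_sqnorm|exact: continuous_g].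
Qed.

End radial.

Section hat.
Context {R : realType}.
Variables (a d : R) (d0 : 0 < d).
Notation leb := (@lebesgue_measure R).

(** The step, rescaled to rise across [[a, a + 2 * d]]. Its derivative [hat] is a bump of mass 1
    centred at [a + d], used as an approximate Dirac mass. *)
Definition ramp (s : R) : R := step ((s - a) / d).
Definition hat (s : R) : R := tent ((s - a) / d) / d.

Lemma is_derive_ramp (s : R) : is_derive s 1 ramp (hat s).
Proof.
apply: (@is_derive1_comp _ step (fun s => (s - a) / d) s _ d^-1 (is_derive_step _)).
rewrite (_ : (fun s => (s - a) / d) = d^-1 *: (id - cst a)); last first.
  by apply/funext => t; rewrite mulrC.
apply: (is_derive_eq (is_deriveZ d^-1 (is_deriveB (is_derive_id s 1) (is_derive_cst a s 1)))).
by rewrite subr0 /GRing.scale /= mulr1.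
Qed.

Lemma continuous_hat : continuous hat.
Proof.
move=> s; apply: (@continuousM _ _ (fun s => tent ((s - a) / d)) (cst d^-1)); last exact: cst_continuous.
apply: (@continuous_comp _ _ _ (fun s => (s - a) / d) tent); last exact: continuous_tent.
apply: (@continuousM _ _ (fun s => s - a) (cst d^-1)); last exact: cst_continuous.
by apply: continuousB; [exact: cvg_id|exact: cst_continuous].
Qed.

Lemma measurable_hat : measurable_fun setT (hat : _ -> measurableTypeR R).
Proof. exact: continuous_measurable_fun continuous_hat. Qed.

Lemma hat_ge0 s : 0 <= hat s.
Proof. by rewrite /hat divr_ge0 ?(ltW d0)//; case/andP: (tent_itv ((s - a) / d)). Qed.

Lemma hat_le s : hat s <= d^-1.
Proof.
by rewrite /hat ler_pdivrMr// mulVf ?gt_eqF//; case/andP: (tent_itv ((s - a) / d)).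
Qed.

Lemma ramp_le s : s <= a -> ramp s = 0.
Proof. by move=> sa; rewrite /ramp step_le0// pmulr_lle0 ?invr_gt0// subr_le0. Qed.

Lemma ramp_ge s : a + 2 * d <= s -> ramp s = 1.
Proof. by move=> sa; rewrite /ramp step_ge2// ler_pdivlMr//; lra. Qed.

Lemma ramp_itv s : 0 <= ramp s <= 1.
Proof. exact: step_itv. Qed.

Lemma hat_out s : ~ (a < s < a + 2 * d) -> hat s = 0.
Proof.
move=> /negP; rewrite negb_and -!leNgt => /orP[sa|sa].
  by rewrite /hat tent_le0 ?mul0r// pmulr_lle0 ?invr_gt0// subr_le0.
by rewrite /hat tent_ge2 ?mul0r// ler_pdivlMr//; lra.
Qed.

Lemma integral_hat : 0 <= a -> (\int[leb]_(s in `[0%R, +oo[) (hat s)%:E = 1)%E.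
Proof.
move=> a0.
have ab : a < a + 2 * d by rewrite ltrDl mulr_gt0.
transitivity (\int[leb]_(s in `[a, (a + 2 * d)%R]) (hat s)%:E)%E.
  rewrite integral_mkcond [RHS]integral_mkcond; apply: eq_integral => s _.
  rewrite !patchE; have [sa|sa] := pselect (a < s < a + 2 * d); last first.
    by rewrite (hat_out sa); case: ifP; case: ifP.
  case/andP: sa => sa sd.
  by rewrite !mem_set//= in_itv /= ?(ltW sa) ?(ltW sd)// andbT; lra.
have cr : continuous ramp.
  by move=> s; apply: differentiable_continuous; apply/derivable1_diffP; have [] := is_derive_ramp s.
rewrite (@continuous_FTC2 _ hat ramp)//.
- by rewrite ramp_ge// ramp_le// sube0.
- exact: continuous_subspaceT continuous_hat.
- split.
  + by move=> s _; have [] := is_derive_ramp s.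
  + by apply: cvg_at_right_filter; exact: cr.
  + by apply: cvg_at_left_filter; exact: cr.
- by move=> s _; rewrite derive1E; have [_ ->] := is_derive_ramp s.
Qed.

End hat.

(** * Divergence theorem for a compactly supported field against a C^1 weight *)

Section integration_by_parts.
Context {R : realType} {N : nat}.
Notation lebN := (@lebesgue_rV R N).
Implicit Types (phi : 'rV[R]_N -> 'rV[R]_N) (u : 'rV[R]_N -> R).

Lemma partial_near0 (i : 'I_N) u x : (\forall y \near x, u y = 0) -> partial i u x = 0.
Proof.
move=> u0; rewrite /partial -(derive_cst (0 : R) x (delta_mx 0 i)).
by apply: near_eq_derive; apply: filterS u0 => y ->.
Qed.

Lemma divergence_near0 phi x : (\forall y \near x, phi y = 0) -> divergence phi x = 0.
Proof.
move=> phi0; rewrite /divergence big1// => i _; apply: partial_near0.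
by apply: filterS phi0 => y ->; rewrite mxE.
Qed.

Lemma near_out_cube (r : R) x : ~ cube r x -> \forall y \near x, ~ @cube R N r y.
Proof.
move=> /notin_cube[i xi].
have c : {for x, continuous (fun y : 'rV[R]_N => `|y 0 i|)}.
  apply: (@continuous_comp _ _ _ (fun y : 'rV[R]_N => y 0 i) (fun t : R => `|t|)).
    exact: coord_continuous.
  exact: norm_continuous.
near=> y; move=> /(_ i); rewrite leNgt => /negP; apply.
by near: y; apply: (cvgr_gt _ c).
Unshelve. all: by end_near. Qed.

Lemma divergence_out_cube (r : R) phi x : (forall y, ~ cube r y -> phi y = 0) ->
  ~ cube r x -> divergence phi x = 0.
Proof.
move=> phi0 xr; apply: divergence_near0.
by apply: filterS (near_out_cube xr) => y /phi0.
Qed.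

Lemma continuous_sum_rV (F : 'I_N -> 'rV[R]_N -> R) : (forall i, continuous (F i)) ->
  continuous (fun x => \sum_(i < N) F i x).
Proof. by move=> cF; apply: continuous_big => [|i _]; [exact: add_continuous|exact: cF]. Qed.

Lemma continuous_divergence phi : C1_field phi -> continuous (divergence phi).
Proof. by move=> [_ cphi]; apply: continuous_sum_rV => i; exact: cphi. Qed.

Lemma differentiable_field phi i x : C1_field phi -> differentiable (fun y => phi y 0 i) x.
Proof.
move=> [dphi _].
apply: (@differentiable_comp _ _ _ _ phi (fun y : 'rV[R]_N => y 0 i)); first exact: dphi.
exact: differentiable_coord.
Qed.

Lemma continuous_field phi i : C1_field phi -> continuous (fun y => phi y 0 i).
Proof. by move=> phi1 x; apply: differentiable_continuous; exact: differentiable_field. Qed.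

(** Sum over [i] of [integral_partial] applied to the products [u phi_i]. The compact support is
    that of the field, so [u] may be a cut-off equal to 1 near the origin. *)
Lemma integration_by_parts_rV u phi (r : R) :
  (forall x, differentiable u x) -> (forall i, continuous (partial i u)) ->
  C1_field phi -> (forall x, ~ cube r x -> phi x = 0) ->
  (\int[lebN]_x (u x * divergence phi x)%:E =
   - \int[lebN]_x (\sum_(i < N) phi x 0 i * partial i u x)%:E)%E.
Proof.
move=> du cdu phi1 phi0.
have cu : continuous u by move=> x; exact: differentiable_continuous.
pose f i x := u x * phi x 0 i.
have df i x : differentiable (f i) x.
  by apply: differentiableM; [exact: du|exact: differentiable_field].
have pf i : partial i (f i) = (fun x => u x * partial i (fun y => phi y 0 i) x + phi x 0 i * partial i u x).
  apply/funext => x; rewrite /partial deriveM//; apply: diff_derivable => //.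
  exact: differentiable_field.
have cpf i : continuous (partial i (f i)).
  rewrite pf => x; apply: (@continuousD _ _ _ (fun x => u x * partial i (fun y => phi y 0 i) x) (fun x => phi x 0 i * partial i u x)).
    by apply: continuousM; [exact: cu|exact: phi1.2].
  by apply: continuousM; [exact: continuous_field|exact: cdu].
have f0 i x : ~ cube r x -> f i x = 0 by move=> /phi0; rewrite /f => ->; rewrite mxE mulr0.
have pf0 i x : ~ cube r x -> partial i (f i) x = 0.
  by move=> xr; apply: partial_near0; apply: filterS (near_out_cube xr) => y /f0.
have intf i : (\int[lebN]_x (partial i (f i) x)%:E = 0)%E.
  apply: (@integral_partial _ _ _ _ r) => //.
  - by move=> x; exact: differentiable_continuous.
  - by move=> x; exact: diff_derivable.
  - exact: f0.
have i1 : lebN.-integrable setT (EFin \o (fun x => u x * divergence phi x)).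
  apply: (@integrable_continuous_cube _ _ _ r) => [x|x xr].
    by apply: continuousM; [exact: cu|exact: continuous_divergence].
  by rewrite (divergence_out_cube phi0 xr) mulr0.
have i2 : lebN.-integrable setT (EFin \o (fun x => \sum_(i < N) phi x 0 i * partial i u x)).
  apply: (@integrable_continuous_cube _ _ _ r) => [|y yr].
    apply: continuous_sum_rV => j y.
    by apply: continuousM; [exact: continuous_field|exact: cdu].
  by rewrite big1// => j _; rewrite (phi0 _ yr) mxE mul0r.
have fB := integrable_fin_num measurableT i2.
rewrite -[LHS](addeK _ fB) -integralD// [X in (X - _)%E](_ : _ = 0%E) ?sub0e//.
rewrite (eq_integral (fun x => \sum_(i < N) (partial i (f i) x)%:E)%E).
  rewrite integral_sum ?big1//.
  by move=> i; apply: (@integrable_continuous_cube _ _ _ r); [exact: cpf|exact: pf0].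
move=> x _; rewrite sumEFin -EFinD; congr EFin.
rewrite /divergence mulr_sumr -big_split /=.
by apply: eq_bigr => i _; rewrite pf.
Qed.

End integration_by_parts.

(** * Perimeter of a ball *)

Section perimeter_ball.
Context {R : realType} {N : nat} (N0 : (0 < N)%N).
Notation lebN := (@lebesgue_rV R N).
Notation leb := (@lebesgue_measure R).
Notation omega := (@unit_ball_volume R N).
Implicit Types (phi : 'rV[R]_N -> 'rV[R]_N) (x y : 'rV[R]_N).

(** Cauchy-Schwarz: expanding [0 <= |x - y / |y||^2] gives [2 <x, y> / |y| <= |x|^2 + 1 <= 2]. *)
Lemma inner_le_enorm x y : enorm x <= 1 -> \sum_(i < N) x 0 i * y 0 i <= enorm y.
Proof.
move=> x1; have [y0|y0] := eqVneq (enorm y) 0.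
  rewrite big1 ?y0// => i _.
  by have := coord_le_enorm y i; rewrite y0 normr_le0 => /eqP ->; rewrite mulr0.
have {}y0 : 0 < enorm y by rewrite lt0r y0 enorm_ge0.
have : 0 <= \sum_(i < N) (x 0 i - y 0 i / enorm y) ^+ 2.
  by apply: sumr_ge0 => i _; exact: sqr_ge0.
under eq_bigr do rewrite sqrrB.
rewrite big_split /= sumrB /= -/(sqnorm x) -sqr_enorm.
rewrite (_ : \sum_(i < N) (y 0 i / enorm y) ^+ 2 = 1); last first.
  under eq_bigr do rewrite exprMn.
  by rewrite -mulr_suml -/(sqnorm y) -sqr_enorm -exprMn divff ?gt_eqF// expr1n.
rewrite (_ : \sum_(i < N) x 0 i * (y 0 i / enorm y) *+ 2 =
    2 * (\sum_(i < N) x 0 i * y 0 i) / enorm y); last first.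
  rewrite mulr_sumr mulr_suml; apply: eq_bigr => i _.
  by move: (_^-1) => c; ring.
have x2 : enorm x ^+ 2 <= 1 by rewrite exprn_ile1// enorm_ge0.
set S := \sum_(i < N) x 0 i * y 0 i => h; rewrite -[leRHS]mul1r -ler_pdivrMr//.
have : 2 * S / enorm y <= 2 by lra.
by rewrite -mulrA ger_pMr.
Qed.

Variables (phi : 'rV[R]_N -> 'rV[R]_N) (r0 : R).
Hypotheses (phi1 : C1_field phi) (phi0 : forall x, ~ cube r0 x -> phi x = 0)
  (phi_le1 : forall x, enorm (phi x) <= 1).

Let divergence_integrable : lebN.-integrable setT (EFin \o divergence phi).
Proof.
apply: (@integrable_continuous_cube _ _ _ r0); first exact: continuous_divergence.
by move=> x; exact: divergence_out_cube.
Qed.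

Variables (r : R) (r_gt0 : 0 < r).
Let rho : R := r ^+ N.

(* The cut-off is supported in the ball itself, where the gradient of |x|^N is at
   most N r^(N-1): the bound holds for every e, before the limit e -> 0. *)
Lemma integral_cutoff_divergence_le (e : R) : 0 < e -> 2 * e < rho ->
  (\int[lebN]_x ((1 - ramp (rho - 2 * e) e (enormN x)) * divergence phi x)%:E <=
   (N%:R * omega * r ^+ N.-1)%:E)%E.
Proof.
move=> e0 er; set a := rho - 2 * e.
have a0 : 0 < a by rewrite subr_gt0.
pose H := ramp a e; pose h := hat a e.
have dH (s : R) : 0 < s -> is_derive s 1 H (h s) by move=> _; exact: is_derive_ramp.
have ch (s : R) : 0 < s -> {for s, continuous h} by move=> _; exact: continuous_hat.
have H0 (s : R) : s < a -> H s = 0 by move=> /ltW; exact: ramp_le.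
have h0 (s : R) : s < a -> h s = 0 by move=> sa; apply: hat_out => // /andP[/(lt_trans sa)]; rewrite ltxx.
pose u x := 1 - H (enormN x).
have du0 x : differentiable (fun x : 'rV[R]_N => H (enormN x)) x.
  exact: (differentiable_radial N0 a0 dH H0 h0).
have uE : u = cst 1 - (fun x : 'rV[R]_N => H (enormN x)) by [].
have du x : differentiable u x.
  by rewrite uE; apply: differentiableB => //; exact: du0.
have pu i x : partial i u x = - (N%:R * h (enormN x) * enormN x / sqnorm x * x 0 i).
  rewrite -(partial_radial N0 a0 dH H0 h0) /partial uE deriveB.
  - by rewrite derive_cst sub0r.
  - exact: derivable_cst.
  - by apply: diff_derivable; exact: du0.
have cpu i : continuous (partial i u).
  rewrite (_ : partial i u = (fun x => - partial i (fun x => H (enormN x)) x)); last first.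
    by apply/funext => x; rewrite pu (partial_radial N0 a0 dH H0 h0).
  by move=> x; apply: continuousN; exact: (continuous_partial_radial N0 a0 dH ch H0 h0).
rewrite (integration_by_parts_rV du cpu phi1 phi0).
have Si : lebN.-integrable setT (EFin \o (fun x => \sum_(i < N) phi x 0 i * partial i u x)).
  apply: (@integrable_continuous_cube _ _ _ r0) => [|x xr].
    apply: continuous_sum_rV => i x.
    by apply: continuousM; [exact: continuous_field|exact: cpu].
  by rewrite big1// => i _; rewrite (phi0 xr) mxE mul0r.
rewrite -integralN; last exact: integrable_add_def.
have mh : measurable_fun setT (fun x => h (enormN x) : measurableTypeR R).
  by apply: (measurableT_comp (measurable_hat a e)); exact: measurable_enormN.
(* Here [- phi . grad u = c <phi, x>] with [c = N h |x|^N / |x|^2], hence at most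
   [c |x| = N h |x|^(N-1)]; and [h] vanishes as soon as [|x| >= r]. *)
have key x : (- (\sum_(i < N) phi x 0 i * partial i u x)%:E <=
    (N%:R * r ^+ N.-1 * h (enormN x))%:E)%E.
  rewrite -EFinN lee_fin.
  have [xr|rx] := leP rho (enormN x).
    have hx0 : h (enormN x) = 0 by apply: hat_out => // /andP[_]; rewrite /a; lra.
    by rewrite hx0 mulr0 big1 ?oppr0// => i _; rewrite pu hx0 !(mulr0, mul0r) oppr0 mulr0.
  have [x0|x0] := eqVneq (enorm x) 0.
    have q0 : sqnorm x = 0 by rewrite -sqr_enorm x0 expr0n.
    rewrite big1 ?oppr0; first by rewrite mulr_ge0 ?hat_ge0// mulr_ge0// exprn_ge0// ltW.
    by move=> i _; rewrite pu q0 invr0 mulr0 mul0r oppr0 mulr0.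
  have {}x0 : 0 < enorm x by rewrite lt0r x0 enorm_ge0.
  set c := N%:R * h (enormN x) * enormN x / sqnorm x.
  have c0 : 0 <= c.
    by rewrite divr_ge0 ?sqnorm_ge0// mulr_ge0 ?enormN_ge0// mulr_ge0 ?hat_ge0.
  rewrite (_ : - _ = c * \sum_(i < N) phi x 0 i * x 0 i); last first.
    by rewrite -sumrN mulr_sumr; apply: eq_bigr => i _; rewrite pu -/c; ring.
  apply: (@le_trans _ _ (c * enorm x)); first by rewrite ler_wpM2l// inner_le_enorm.
  have sE : enormN x = enorm x * enorm x ^+ N.-1 by rewrite -exprS prednK.
  rewrite /c -sqr_enorm [X in _ * X / _]sE.
  rewrite (_ : _ * enorm x = N%:R * h (enormN x) * enorm x ^+ N.-1); last first.
    by field; rewrite gt_eqF.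
  rewrite mulrAC ler_wpM2r ?hat_ge0// ler_wpM2l// lerXn2r ?nnegrE ?enorm_ge0 ?(ltW r_gt0)//.
  by rewrite -(@ler_pXn2r _ N) ?nnegrE ?enorm_ge0 ?(ltW r_gt0)// ltW.
apply: (@le_trans _ _ (\int[lebN]_x (N%:R * r ^+ N.-1 * h (enormN x))%:E)%E).
  apply: le_integral => //.
  - exact: integrableN.
  - apply: (@integrable_continuous_cube _ _ _ r) => x.
      apply: (@continuousM _ _ (cst (N%:R * r ^+ N.-1)) (fun x => h (enormN x))).
        exact: cst_continuous.
      apply: (@continuous_comp _ _ _ (@enormN R N) h); last exact: continuous_hat.
      exact: continuous_enormN.
    move=> xr; rewrite /h hat_out ?mulr0// => /andP[_].
    rewrite ltNge => /negP; apply; rewrite /a subrK.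
    have [i xi] := notin_cube xr.
    rewrite /enormN lerXn2r ?nnegrE ?enorm_ge0 ?(ltW r_gt0)//.
    by rewrite (le_trans (ltW xi))// coord_le_enorm.
under eq_integral do rewrite EFinM.
have c0 : 0 <= N%:R * r ^+ N.-1 by rewrite mulr_ge0// exprn_ge0// ltW.
rewrite ge0_integralZl//; last 2 first.
- by apply/measurable_EFinP.
- by move=> x _; rewrite lee_fin hat_ge0.
(* The bound depends on [x] only through [|x|^N]: the image measure yields the factor [omega], and
   the bump has mass 1 whatever [e] is. *)
rewrite (@ge0_integral_enormN _ _ N0 (fun s => (h s)%:E)).
- by rewrite integral_hat ?(ltW a0)// mule1 -EFinM lee_fin mulrAC.
- by apply/measurable_EFinP; exact: measurable_hat.
- by move=> t; rewrite lee_fin hat_ge0.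
Qed.

(** The cut-offs converge pointwise to the indicator of the open ball and are dominated by 1, so
    their common bound passes to the limit. *)
Lemma integral_ball_divergence_le :
  (\int[lebN]_x (\1_(eball r) x * divergence phi x)%:E <=
   (N%:R * omega * r ^+ N.-1)%:E)%E.
Proof.
have rho0 : 0 < rho by rewrite exprn_gt0.
pose e n : R := rho / 4 * n.+1%:R^-1.
have e0 n : 0 < e n by rewrite mulr_gt0 ?divr_gt0 ?invr_gt0.
have er n : 2 * e n < rho.
  have : n.+1%:R^-1 <= 1 :> R by rewrite invf_le1// ler1n.
  by rewrite /e; move: (n.+1%:R^-1 : R) => z z1; nra.
have ecvg : e n @[n --> \oo] --> (0 : R).
  rewrite -[X in _ --> X](mulr0 (rho / 4)).
  by apply: cvgM; [exact: cvg_cst|exact: cvg_harmonic].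
pose f n x := ((1 - ramp (rho - 2 * e n) (e n) (enormN x)) * divergence phi x)%:E.
have md : measurable_fun setT (divergence phi : _ -> measurableTypeR R).
  by apply: continuous_measurable_rV; exact: continuous_divergence.
have [] := @dominated_convergence _ _ R lebN setT measurableT f
  (fun x => (\1_(eball r) x * divergence phi x)%:E) (abse \o (EFin \o divergence phi)).
- move=> n; apply/measurable_EFinP; apply: measurable_funM => //.
  apply: measurable_funB; first exact: measurable_cst.
  apply: (measurableT_comp (f := ramp (rho - 2 * e n) (e n))); last exact: measurable_enormN.
  apply: continuous_measurable_fun => s; apply: differentiable_continuous.
  by apply/derivable1_diffP; have [] := is_derive_ramp (rho - 2 * e n) (e n) s.
- apply/measurable_EFinP; apply: measurable_funM => //.
  by apply: measurable_indic; exact: measurable_eball.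
- apply/aeW => x _; rewrite indicE; have [xr|rx] := ltP (enorm x) r.
    rewrite mem_set// mul1r; apply: cvg_near_cst.
    have sx : 0 < (rho - enormN x) / 2.
      by rewrite divr_gt0// subr_gt0 ltr_pXn2r// ?nnegrE ?enorm_ge0 ?(ltW r_gt0).
    near=> n; have en : e n < (rho - enormN x) / 2 by near: n; apply: (cvgr_lt _ ecvg).
    by rewrite /f ramp_le ?subr0 ?mul1r//; move: en; lra.
  (* On the sphere and outside it the ramp has already reached 1, so every cut-off is 0, as for the
     open ball. *)
  rewrite memNset/=; last by rewrite /eball /=; apply/negP; rewrite -leNgt.
  rewrite mul0r; apply: cvg_near_cst; apply: nearW => n.
  rewrite /f ramp_ge ?subrr ?mul0r// subrK.
  by rewrite /enormN lerXn2r ?nnegrE ?enorm_ge0 ?(ltW r_gt0).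
- exact: integrable_abse.
- apply/aeW => x n _; rewrite /f /= lee_fin normrM ler_piMl//.
  have /andP[h0 h1] := ramp_itv (rho - 2 * e n) (e n) (enormN x).
  by rewrite ger0_norm; lra.
move=> _ _ c; rewrite -(cvg_lim _ c)//; apply: lime_le.
  by apply/cvg_ex; exists (\int[lebN]_x (\1_(eball r) x * divergence phi x)%:E)%E.
by apply: nearW => n; exact: integral_cutoff_divergence_le.
Unshelve. all: by end_near. Qed.

End perimeter_ball.

Section perimeter_annulus.
Context {R : realType} {N : nat} (N0 : (0 < N)%N).
Notation lebN := (@lebesgue_rV R N).
Notation omega := (@unit_ball_volume R N).

Lemma coord_le_norm (x : 'rV[R]_N) i : `|x 0 i| <= `|x|.
Proof.
rewrite /Num.norm/= mx_normrE.
exact: (@le_bigmax _ _ _ 0 (fun ij : 'I_1 * 'I_N => `|x ij.1 ij.2|) (0, i)).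
Qed.

Lemma test_fields_cube U phi : @test_fields R N U phi ->
  exists r, forall x, ~ cube r x -> phi x = 0.
Proof.
move=> [_ /compact_bounded[M [_ sM]] _ _]; exists (`|M| + 1) => x xr.
apply/eqP/negPn/negP => px; apply: xr => i; apply: le_trans (coord_le_norm _ _) _.
apply: (sM (`|M| + 1)); first by rewrite (le_lt_trans (ler_norm M))// ltrDl.
exact: subset_closure.
Qed.

Lemma divergence_out_supp U phi x : @test_fields R N U phi -> ~ U x ->
  divergence phi x = 0.
Proof.
move=> [_ _ sU _] Ux; apply: divergence_near0.
have : nbhs x (~` supp phi).
  apply: open_nbhs_nbhs; split; last by move=> /sU.
  exact/closed_openC/closed_closure.
apply: filterS => y; apply: contra_notP => /eqP py; exact: subset_closure.
Qed.

(** A test field is supported in the interior of [A_{l,L}], where belonging to [A_{l,r}] is the same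
    as belonging to the ball of radius [r]: the inner sphere lies on the boundary of the domain and
    is not counted. *)
Lemma perimeter_annulus_le (l r L : R) : 0 < r ->
  (perimeter (@annulus R N l r) (annulus l L) <= (N%:R * omega * r ^+ N.-1)%:E)%E.
Proof.
move=> r0; apply: ge_ereal_sup => _ [phi tphi <-].
have [r1 phi0] := test_fields_cube tphi.
have [phi1 _ _ phi_le1] := tphi.
apply: le_trans (integral_ball_divergence_le N0 phi1 phi0 phi_le1 r0).
rewrite integral_mkcond le_eqVlt; apply/orP; left; apply/eqP.
apply: eq_integral => x _; rewrite patchE; case: ifPn => [|]; last first.
  by rewrite notin_setE => /(divergence_out_supp tphi) ->; rewrite mulr0.
rewrite inE => /interior_subset[xL xl]; congr (_ * _)%:E; rewrite !indicE; congr (nat_of_bool _)%:R.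
by apply/idP/idP; rewrite !inE; [case|split].
Qed.

End perimeter_annulus.

(** * Lower bound for the perimeter of a radial set *)

Lemma derive_coord {R : realType} {N : nat} (i j : 'I_N) (x : 'rV[R]_N) :
  'D_(delta_mx 0 i) (fun y : 'rV[R]_N => y 0 j) x = (i == j)%:R.
Proof.
rewrite /derive; apply: cvg_lim => //; apply: cvg_near_cst.
near=> h; have h0 : h != 0 by near: h; exact: nbhs_dnbhs_neq.
by rewrite /= !mxE eqxx addrK /GRing.scale /= mulKf// eq_sym.
Unshelve. all: by end_near. Qed.

Section radial_field.
Context {R : realType} {N : nat} (N0 : (0 < N)%N).
Notation lebN := (@lebesgue_rV R N).
Implicit Types (x y : 'rV[R]_N).
Variables (k L a b d : R).
Hypotheses (k0 : 0 <= k) (kL : k < L) (d0 : 0 < d) (ka : k ^+ N < a) (kb : k ^+ N < b)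
  (aL : a + 2 * d < L ^+ N) (bL : b + 2 * d < L ^+ N).

(* Psi rises to C after a and comes back to 0 after b (or goes down to -C in between
   if b < a). The field H(|x|^N) x has divergence N Psi'(|x|^N). *)
Let sigma : R := Num.min a b.
Let C : R := k ^+ N.-1.
Let Psi (s : R) : R := C * (ramp a d s - ramp b d s).
Let psi (s : R) : R := C * (hat a d s - hat b d s).
Let H (s : R) : R := Psi s / s.
Let h (s : R) : R := psi s / s - Psi s / s ^+ 2.

Let sigma_gt : k ^+ N < sigma. Proof. by rewrite lt_min ka. Qed.

Let sigma_gt0 : 0 < sigma.
Proof. by apply: le_lt_trans sigma_gt; exact: exprn_ge0. Qed.

Let Psi_small (s : R) : s <= sigma -> Psi s = 0.
Proof. by rewrite le_min => /andP[sa sb]; rewrite /Psi !ramp_le// subrr mulr0. Qed.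

Let psi_small (s : R) : s <= sigma -> psi s = 0.
Proof.
rewrite le_min => /andP[sa sb].
by rewrite /psi !hat_out ?subrr ?mulr0// => /andP[]; rewrite ltNge ?sa ?sb.
Qed.

Let Psi_large (s : R) : Num.max a b + 2 * d <= s -> Psi s = 0.
Proof.
move=> abs; have /andP[sa sb] : (a <= s - 2 * d) && (b <= s - 2 * d) by rewrite -ge_max; lra.
by rewrite /Psi !ramp_ge ?subrr ?mulr0//; lra.
Qed.

Let is_derive_Psi (s : R) : is_derive s 1 Psi (psi s).
Proof.
exact: (is_deriveZ C (is_deriveB (is_derive_ramp a d s) (is_derive_ramp b d s))).
Qed.

Let is_derive_H (s : R) : 0 < s -> is_derive s 1 H (h s).
Proof.
move=> s0; have s1 : s != 0 by rewrite gt_eqF.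
have dV : is_derive s 1 (fun t : R => t^-1) (- s ^- 2).
  split; first by apply: derivableV.
  by rewrite (@deriveV _ _ id)// derive_id /GRing.scale /= mulr1.
apply: (is_derive_eq (is_deriveM (is_derive_Psi s) dV)).
by rewrite /h /GRing.scale /=; field.
Qed.

Let continuous_Psi : continuous Psi.
Proof.
move=> s; apply: differentiable_continuous; apply/derivable1_diffP.
by have [] := is_derive_Psi s.
Qed.

Let continuous_h (s : R) : 0 < s -> {for s, continuous h}.
Proof.
move=> s0; have s1 : s != 0 by rewrite gt_eqF.
apply: (@continuousB _ _ _ (fun s => psi s / s) (fun s => Psi s / s ^+ 2)).
  apply: continuousM; last by apply: continuousV => //; exact: cvg_id.
  apply: (@continuousM _ _ (cst C) (fun s => hat a d s - hat b d s)); first exact: cst_continuous.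
  by apply: (@continuousB _ _ _ (hat a d) (hat b d)); exact: continuous_hat.
apply: continuousM; first exact: continuous_Psi.
by apply: continuousV; [rewrite expf_neq0|exact: exprn_continuous].
Qed.

Let H_small (s : R) : s < sigma -> H s = 0.
Proof. by move=> /ltW ss; rewrite /H Psi_small// mul0r. Qed.

Let h_small (s : R) : s < sigma -> h s = 0.
Proof. by move=> /ltW ss; rewrite /h Psi_small// psi_small// !mul0r subrr. Qed.

Definition radial_field (x : 'rV[R]_N) : 'rV[R]_N := H (enormN x) *: x.

Let dr (x : 'rV[R]_N) : differentiable (fun x : 'rV[R]_N => H (enormN x)) x.
Proof. exact: (differentiable_radial N0 sigma_gt0 is_derive_H H_small h_small). Qed.

Let coordE j : (fun y : 'rV[R]_N => radial_field y 0 j) =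
  (fun y : 'rV[R]_N => H (enormN y)) * (fun y : 'rV[R]_N => y 0 j).
Proof. by apply/funext => y; rewrite /radial_field mxE. Qed.

Let partial_field i j x : partial i (fun y => radial_field y 0 j) x =
  H (enormN x) * (i == j)%:R +
  x 0 j * (N%:R * h (enormN x) * enormN x / sqnorm x * x 0 i).
Proof.
rewrite -(partial_radial N0 sigma_gt0 is_derive_H H_small h_small) coordE.
rewrite /partial deriveM.
- congr (_ *: _ + _).
  exact: derive_coord.
- by apply: diff_derivable; exact: dr.
- by apply: diff_derivable; exact: differentiable_coord.
Qed.

Lemma C1_radial_field : C1_field radial_field.
Proof.
split.
  move=> x; have -> : radial_field = \sum_(j < N) (fun y => radial_field y 0 j *: (delta_mx 0 j : 'rV[R]_N)).
    by apply/funext => y; rewrite fct_sumE; exact: row_sum_delta.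
  apply: differentiable_sum => j; apply: differentiableZl; rewrite coordE.
  by apply: differentiableM; [exact: dr|exact: differentiable_coord].
move=> i j.
rewrite (_ : partial i _ = (fun x => H (enormN x) * (i == j)%:R +
  x 0 j * partial i (fun x : 'rV[R]_N => H (enormN x)) x)); last first.
  apply/funext => x; rewrite partial_field.
  by rewrite -(partial_radial N0 sigma_gt0 is_derive_H H_small h_small).
move=> x; apply: (@continuousD _ _ _ (fun x => H (enormN x) * (i == j)%:R)
  (fun x => x 0 j * partial i (fun x : 'rV[R]_N => H (enormN x)) x)).
  apply: (@continuousM _ _ (fun x => H (enormN x)) (cst (i == j)%:R)); last exact: cst_continuous.
  by apply: differentiable_continuous; exact: dr.
apply: (@continuousM _ _ (fun x : 'rV[R]_N => x 0 j)); first exact: coord_continuous.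
exact: (continuous_partial_radial N0 sigma_gt0 is_derive_H continuous_h H_small h_small).
Qed.

(** At [s = |x|^N] the divergence of [H(s) x] is [N (H + s h) = N (s H)'], and [s H = Psi]; the
    factor [1 / s] in [H] is there to produce this exact derivative. *)
Lemma divergence_radial_field x : divergence radial_field x =
  N%:R * k ^+ N.-1 * (hat a d (enormN x) - hat b d (enormN x)).
Proof.
rewrite /divergence; under eq_bigr do rewrite partial_field eqxx mulr1.
rewrite big_split /= sumr_const card_ord.
have [xs|sx] := leP (enormN x) sigma.
  have h0 : h (enormN x) = 0 by rewrite /h Psi_small// psi_small// !mul0r subrr.
  rewrite /H Psi_small// mul0r mul0rn add0r big1.
    by rewrite -mulrA -/C -/(psi (enormN x)) psi_small// mulr0.
  by move=> i _; rewrite h0 !(mulr0, mul0r).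
have s0 : enormN x != 0 by rewrite gt_eqF// (lt_trans sigma_gt0).
have q0 : sqnorm x != 0.
  by rewrite -sqr_enorm expf_neq0//; apply: contra_neq s0; rewrite /enormN => ->; rewrite expr0n gtn_eqF.
under eq_bigr do rewrite mulrCA -expr2.
rewrite -mulr_sumr -/(sqnorm x) -mulr_natl divfK//.
by rewrite /H /h /psi -/C; field.
Qed.

(** The norm is [|Psi| / |x|^(N-1)]. A difference of two ramps lies in [[-1, 1]], so
    [|Psi| <= k^(N-1)], and [Psi] is 0 unless [|x| > k]. *)
Lemma enorm_radial_field x : enorm (radial_field x) <= 1.
Proof.
rewrite /radial_field enormZ /H.
have [xs|sx] := leP (enormN x) sigma; first by rewrite Psi_small// mul0r normr0 mul0r ler01.
have s0 : 0 < enormN x by exact: lt_trans sx.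
have e0 : 0 < enorm x.
  by rewrite lt0r enorm_ge0 andbT; apply: contraTneq s0; rewrite /enormN => ->; rewrite expr0n gtn_eqF// ltxx.
have C0 : 0 <= C by exact: exprn_ge0.
have P1 : `|Psi (enormN x)| <= C.
  rewrite /Psi normrM ger0_norm// ler_piMr//.
  have /andP[? ?] := ramp_itv a d (enormN x); have /andP[? ?] := ramp_itv b d (enormN x).
  by rewrite ler_norml; apply/andP; split; lra.
rewrite normrM normfV (gtr0_norm s0) mulrAC ler_pdivrMr// mul1r.
rewrite [leRHS](_ : _ = enorm x ^+ N.-1 * enorm x); last by rewrite -exprSr prednK.
rewrite ler_wpM2r ?enorm_ge0// (le_trans P1)// /C lerXn2r ?nnegrE ?enorm_ge0//.
rewrite -(@ler_pXn2r _ N) ?nnegrE ?enorm_ge0//.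
by rewrite ltW// (lt_trans sigma_gt).
Qed.

(** A closed shell outside which the field vanishes. It lies strictly between the radii [k] and [L],
    so the closure taken in [supp] stays inside the open annulus. *)
Let K : set 'rV[R]_N := @enormN R N @^-1` `[sigma, Num.max a b + 2 * d].

Let closed_K : closed K.
Proof.
apply: closed_comp; last exact: itv_closed.
by move=> x _; exact: continuous_enormN.
Qed.

Let supp_K : supp radial_field `<=` K.
Proof.
rewrite [X in _ `<=` X](closure_id K).1//; apply: closure_subset => x /= fx.
rewrite /K /= in_itv /= !leNgt.
apply/andP; split; apply: contra_neqN fx => xs; rewrite /radial_field.
  by rewrite H_small ?scale0r.
by rewrite /H Psi_large ?mul0r ?scale0r// ltW.
Qed.

Let K_lt (x : 'rV[R]_N) : K x -> k ^+ N < enormN x < L ^+ N.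
Proof.
rewrite /K /= in_itv /= => /andP[s1 s2]; rewrite (lt_le_trans sigma_gt)//=.
by rewrite (le_lt_trans s2)// -ltrBrDr gt_max !ltrBrDr aL.
Qed.

Let K_annulus : K `<=` [set x | k < enorm x < L].
Proof.
move=> x /K_lt; rewrite /enormN !ltr_pXn2r ?nnegrE ?enorm_ge0//.
by rewrite ltW// (le_lt_trans k0).
Qed.

Lemma test_radial_field : test_fields (annulus k L)° radial_field.
Proof.
split.
- exact: C1_radial_field.
- apply: (subclosed_compact (@closed_closure _ _) (@compact_cube R N L)) => x /supp_K /K_annulus /andP[_ xL] i.
  by rewrite (le_trans (coord_le_enorm _ _))// ltW.
- apply: (subset_trans supp_K); apply: (subset_trans K_annulus).
  rewrite -open_subsetE.
    by move=> x /= /andP[kx xL]; split => //; rewrite /eball /=; apply/negP; rewrite -leNgt ltW.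
  rewrite (_ : mkset _ = @enorm R N @^-1` `]k, L[); last first.
    by apply/seteqP; split => x /=; rewrite in_itv.
  by apply: open_comp; [move=> x _; exact: continuous_enorm|exact: itv_open].
- exact: enorm_radial_field.
Qed.

End radial_field.

Section perimeter_ge.
Context {R : realType} {N : nat} (N0 : (0 < N)%N).
Notation lebN := (@lebesgue_rV R N).
Notation leb := (@lebesgue_measure R).
Notation omega := (@unit_ball_volume R N).
Variables (l k L : R) (l0 : 0 <= l) (lk : l <= k) (kL : k < L).
Variables (D : set 'rV[R]_N) (E : set (measurableTypeR R)).
Hypotheses (mD : measurable D) (mE : measurable E)
  (DE : {ae lebN, forall x, D x <-> E (enormN x)}).

Let k0 : 0 <= k. Proof. exact: le_trans lk. Qed.

Let hatE (a d : R) : 0 < d ->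
  (\int[lebN]_x (\1_D x * hat a d (enormN x))%:E =
   omega%:E * \int[leb]_(s in `[0%R, +oo[) (\1_E s * hat a d s)%:E)%E.
Proof.
move=> d0.
have mg : measurable_fun setT (fun s : measurableTypeR R => (\1_E s * hat a d s)%:E).
  by apply/measurable_EFinP; apply: measurable_funM; [exact: measurable_indic|exact: measurable_hat].
rewrite -(@ge0_integral_enormN _ _ N0 (fun s => (\1_E s * hat a d s)%:E))//; last first.
  by move=> t; rewrite lee_fin mulr_ge0 ?hat_ge0// indicE; case: (_ \in _).
apply: ae_eq_integral => //.
- apply/measurable_EFinP; apply: measurable_funM; first exact: measurable_indic.
  by apply: (measurableT_comp (measurable_hat a d)); exact: measurable_enormN.
- exact: (measurableT_comp mg (@measurable_enormN _ _)).
apply: filterS DE => x DEx _; congr (_ * _)%:E; rewrite !indicE; congr (nat_of_bool _)%:R.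
by apply/idP/idP; rewrite !inE => /DEx.
Qed.

Let hat_fin (a d : R) : 0 < d -> 0 <= a ->
  (\int[leb]_(s in `[0%R, +oo[) (\1_E s * hat a d s)%:E)%E \is a fin_num.
Proof.
move=> d0 a0; rewrite ge0_fin_numE; last first.
  by apply: integral_ge0 => s _; rewrite lee_fin mulr_ge0 ?hat_ge0.
apply: (@le_lt_trans _ _ 1%E); last by rewrite ltry.
rewrite -(integral_hat d0 a0); apply: ge0_le_integral => //.
- by move=> s _; rewrite lee_fin mulr_ge0 ?hat_ge0.
- apply/measurable_EFinP/measurable_funTS; apply: measurable_funM; first exact: measurable_indic.
  exact: measurable_hat.
- by apply/measurable_EFinP/measurable_funTS; exact: measurable_hat.
- by move=> s _; rewrite lee_fin ler_piMl ?hat_ge0// indicE; case: (_ \in _).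
Qed.

(** Testing with [radial_field] compares two averages of [\1_E], one around [a + d] and one around
    [b + d]. The divergence vanishes off the domain, so the integral extends to the whole space and
    is transported to the half-line. *)
Lemma perimeter_ge_hat (a b d : R) : 0 < d -> k ^+ N < a -> k ^+ N < b ->
  a + 2 * d < L ^+ N -> b + 2 * d < L ^+ N ->
  ((N%:R * k ^+ N.-1 * omega)%:E *
    (\int[leb]_(s in `[0%R, +oo[) (\1_E s * hat a d s)%:E -
     \int[leb]_(s in `[0%R, +oo[) (\1_E s * hat b d s)%:E) <= perimeter D (annulus l L))%E.
Proof.
move=> d0 ka kb aL bL.
pose phi := @radial_field R N k a b d.
have t1 : test_fields (annulus k L)° phi := test_radial_field N0 k0 kL d0 ka kb aL bL.
have kl : (@annulus R N k L)° `<=` (annulus l L)°.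
  apply: interiorS => x [xL xk]; split => //; apply: contra_not xk.
  by move=> /lt_le_trans; exact.
have t2 : test_fields (annulus l L)° phi.
  by case: t1 => h1 h2 h3 h4; split => //; exact: subset_trans kl.
apply: le_ereal_sup_tmp.
exists (\int[@lebesgue_rV R N]_(x in (annulus l L)°) (\1_D x * divergence phi x)%:E)%E; first by exists phi.
have dE x : divergence phi x = N%:R * k ^+ N.-1 * (hat a d (enormN x) - hat b d (enormN x)).
  exact: divergence_radial_field.
rewrite [leRHS]integral_mkcond.
rewrite [leRHS](eq_integral (fun x => (N%:R * k ^+ N.-1)%:E *
   ((\1_D x * hat a d (enormN x))%:E - (\1_D x * hat b d (enormN x))%:E))%E); last first.
  move=> x _; rewrite patchE; case: ifPn => [|]; last first.
    rewrite notin_setE => /(divergence_out_supp t2); rewrite dE -EFinB -EFinM => dx.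
    by rewrite -mulrBr mulrCA dx mulr0.
  by move=> _; rewrite dE -EFinB -EFinM -mulrBr mulrCA.
have hi c : k ^+ N < c -> c + 2 * d < L ^+ N ->
    lebN.-integrable setT (EFin \o (fun x => \1_D x * hat c d (enormN x))).
  move=> kc cL; apply: (@integrable_cube _ _ _ L d^-1).
  - apply: measurable_funM; first exact: measurable_indic.
    by apply: (measurableT_comp (measurable_hat c d)); exact: measurable_enormN.
  - move=> x; rewrite indicE; case: (_ \in _); rewrite ?mul0r ?normr0 ?invr_ge0 ?(ltW d0)//.
    by rewrite mul1r ger0_norm ?hat_ge0// hat_le.
  - move=> x xL; rewrite hat_out ?mulr0// => /andP[_].
    apply/negP; rewrite -leNgt (le_trans (ltW cL))//.
    have L0 : 0 <= L by rewrite ltW// (le_lt_trans k0).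
    have [i xi] := notin_cube xL.
    rewrite /enormN lerXn2r ?nnegrE ?enorm_ge0//.
    by rewrite (le_trans (ltW xi))// coord_le_enorm.
rewrite integralZl//; last by apply: integrableB => //; exact: hi.
rewrite integralB//; [|exact: hi|exact: hi].
have a0 : 0 <= a by rewrite ltW// (le_lt_trans _ ka)// exprn_ge0.
have b0 : 0 <= b by rewrite ltW// (le_lt_trans _ kb)// exprn_ge0.
rewrite !hatE// -muleBr//; last by rewrite fin_num_adde_defr// hat_fin.
by rewrite muleA -EFinM.
Qed.

End perimeter_ge.

(** * Averages of an indicator near a density point *)

Section density.
Context {R : realType}.
Notation leb := (@lebesgue_measure R).

Lemma density_point (A I : set (measurableTypeR R)) : measurable A -> measurable I ->
  (0 < leb (A `&` I))%E ->
  exists2 p : R, I p & forall e : R, 0 < e ->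
    \forall r \near 0^'+, (leb (~` A `&` ball p r) <= (e * r)%:E)%E.
Proof.
move=> mA mI AI0.
have mC : measurable (~` A) by exact: measurableC.
have [Z [mZ Z0 subZ]] := lebesgue_density mC.
have [p [[Ap Ip] Zp]] : exists p, (A `&` I) p /\ ~ Z p.
  apply/not_existsP => h; have AIZ : A `&` I `<=` Z.
    by move=> x AIx; apply: contrapT => Zx; exact: (h x).
  move: AI0; rewrite ltNge => /negP; apply; rewrite -Z0.
  by apply: le_measure => //; rewrite inE//; exact: measurableI.
exists p => // e e0.
have : (leb (~` A `&` ball p r) * (leb (ball p r))^-1)%E @[r --> 0^'+] --> 0%E.
  have : (\1_(~` A) p)%:E = 0%E :> \bar R by rewrite indicE memNset.
  by move=> <-; apply: contrapT => h; apply: Zp; exact: subZ.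
move=> /fine_cvgP[fin c].
near=> r; have r0 : 0 < r by near: r; exact: nbhs_right_gt.
have f1 : (leb (~` A `&` ball p r) * (leb (ball p r))^-1)%E \is a fin_num by near: r.
(* [e / 2] because [ball p r] has measure [2 * r]. *)
have f2 : fine (leb (~` A `&` ball p r) * (leb (ball p r))^-1)%E < e / 2.
  by near: r; apply: (cvgr_lt _ c); rewrite divr_gt0.
have iE : ((leb (ball p r))^-1 = ((r *+ 2)^-1)%:E)%E.
  by rewrite lebesgue_measure_ball ?ltW// inver mulrn_eq0/= gt_eqF.
move: f1 f2; rewrite iE.
set m := leb _ => f1.
have mfin : m \is a fin_num.
  rewrite /m ge0_fin_numE ?measure_ge0//; apply: (@le_lt_trans _ _ (leb (ball p r))).
    apply: le_measure; rewrite ?inE//; last exact: measurable_ball.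
    by apply: measurableI => //; exact: measurable_ball.
  by rewrite lebesgue_measure_ball ?ltW// ltry.
rewrite -(fineK mfin) -EFinM /= lee_fin ltr_pdivrMr ?mulrn_wgt0// => /ltW.
by rewrite (_ : e / 2 * (r *+ 2) = e * r)//; field.
Unshelve. all: by end_near. Qed.

Lemma integral_indic_hat_le (A : set (measurableTypeR R)) (p r : R) : measurable A -> 0 < r ->
  (\int[leb]_(s in `[0%R, +oo[) (\1_A s * hat (p - r) r s)%:E <=
   (r^-1)%:E * leb (A `&` ball p r))%E.
Proof.
move=> mA r0; have mB : measurable (A `&` ball p r) by apply: measurableI => //; exact: measurable_ball.
apply: (@le_trans _ _ (\int[leb]_(s in `[0%R, +oo[) ((r^-1)%:E * (\1_(A `&` ball p r) s)%:E)))%E.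
  apply: ge0_le_integral => //.
  - by move=> s _; rewrite lee_fin mulr_ge0 ?hat_ge0.
  - apply/measurable_EFinP/measurable_funTS; apply: measurable_funM; first exact: measurable_indic.
    exact: measurable_hat.
  - apply: measurable_funeM; apply/measurable_EFinP/measurable_funTS; exact: measurable_indic.
  move=> s _; rewrite -EFinM lee_fin !indicE.
  have [sp|sp] := pselect (p - r < s < p - r + 2 * r).
    have bs : ball p r s by rewrite /ball /= ltr_norml; case/andP: sp => *; apply/andP; split; lra.
    rewrite in_setI (mem_set bs) andbT mulrC ler_wpM2r ?hat_le//.
  by rewrite hat_out// mulr0 mulr_ge0// invr_ge0 ltW.
rewrite ge0_integralZl//; last 2 first.
- by apply/measurable_EFinP/measurable_funTS; exact: measurable_indic.
- by rewrite lee_fin invr_ge0 ltW.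
rewrite integral_indic// lee_pmul2l ?lte_fin ?invr_gt0//.
apply: le_measure; rewrite ?inE//; apply: measurableI => //; exact: measurable_itv.
Qed.

(** [r <= p] keeps the bump on the half-line, so its mass is 1; the part carried by the complement
    of [A] is bounded by [integral_indic_hat_le]. *)
Lemma integral_indic_hat_ge (A : set (measurableTypeR R)) (p r : R) : measurable A -> 0 < r ->
  r <= p ->
  (1 - (r^-1)%:E * leb (~` A `&` ball p r) <=
   \int[leb]_(s in `[0%R, +oo[) (\1_A s * hat (p - r) r s)%:E)%E.
Proof.
move=> mA r0 rp.
have mg B : measurable B -> measurable_fun (`[0%R, +oo[ : set (measurableTypeR R)) (fun s : measurableTypeR R => (\1_B s * hat (p - r) r s)%:E).
  move=> mB; apply/measurable_EFinP/measurable_funTS; apply: measurable_funM; first exact: measurable_indic.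
  exact: measurable_hat.
rewrite leeBlDr; last first.
  rewrite fin_numM// ge0_fin_numE//; apply: (@le_lt_trans _ _ (leb (ball p r))).
    apply: le_measure; rewrite ?inE//; last exact: measurable_ball.
    by apply: measurableI; [exact: measurableC|exact: measurable_ball].
  by rewrite lebesgue_measure_ball ?ltW// ltry.
have pr0 : 0 <= p - r by rewrite subr_ge0.
rewrite -(integral_hat r0 pr0).
rewrite (eq_integral (fun s => (\1_A s * hat (p - r) r s)%:E + (\1_(~` A) s * hat (p - r) r s)%:E)%E).
  rewrite ge0_integralD//.
  - by rewrite leeD2l// integral_indic_hat_le//; exact: measurableC.
  - by move=> s _; rewrite lee_fin mulr_ge0 ?hat_ge0.
  - exact: mg.
  - by move=> s _; rewrite lee_fin mulr_ge0 ?hat_ge0.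
  - by apply: mg; exact: measurableC.
move=> s _; rewrite -EFinD -mulrDl !indicE in_setC.
by case: (s \in A); rewrite ?addr0 ?add0r mul1r.
Qed.

End density.

Section perimeter_ge.
Context {R : realType} {N : nat} (N0 : (0 < N)%N).
Notation lebN := (@lebesgue_rV R N).
Notation leb := (@lebesgue_measure R).
Notation omega := (@unit_ball_volume R N).

(** For small bumps the average of [\1_E] is at least [1 - e] around a density point [p] of [E], and
    at most [e] around a density point [q] of the complement. Both points lie in the open interval,
    which leaves room for the bumps; then [e] tends to 0. *)
Lemma perimeter_ge (l k L : R) (D : set 'rV[R]_N) (E : set (measurableTypeR R)) :
  0 <= l -> l <= k -> k < L -> measurable D -> measurable E ->
  {ae lebN, forall x, D x <-> E (enormN x)} ->
  (0 < leb (E `&` `](k ^+ N)%R, (L ^+ N)%R[))%E -> (0 < leb (~` E `&` `](k ^+ N)%R, (L ^+ N)%R[))%E ->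
  ((N%:R * k ^+ N.-1 * omega)%:E <= perimeter D (annulus l L))%E.
Proof.
move=> l0 lk kL mD mE DE E0 CE0.
have mI : measurable (`]k ^+ N, L ^+ N[%classic : set (measurableTypeR R)) by exact: measurable_itv.
have [p + pE] := density_point mE mI E0.
have [q + qE] := density_point (measurableC mE) mI CE0.
rewrite /= !in_itv /= => /andP[kq qL] /andP[kp pL].
set c := N%:R * k ^+ N.-1 * omega.
have c0 : 0 <= c.
  by rewrite /c mulr_ge0 ?(ltW (@unit_ball_volume_gt0 R N))// mulr_ge0// exprn_ge0// (le_trans l0).
have key (e : R) : 0 < e -> ((c * (1 - 2 * e))%:E <= perimeter D (annulus l L))%E.
  move=> e0; suff [r [r0 rp rq re1 re2]] : exists r : R, [/\ 0 < r,
     k ^+ N < p - r /\ p + r < L ^+ N, k ^+ N < q - r /\ q + r < L ^+ N,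
     (leb (~` E `&` ball p r) <= (e * r)%:E)%E & (leb (E `&` ball q r) <= (e * r)%:E)%E].
    have := perimeter_ge_hat N0 l0 lk kL mD mE DE r0 (a := p - r) (b := q - r).
    rewrite -/c => /(_ rp.1 rq.1); rewrite (_ : p - r + 2 * r = p + r); last by ring.
    rewrite (_ : q - r + 2 * r = q + r); last by ring.
    move=> /(_ rp.2 rq.2); apply: le_trans.
    rewrite EFinM lee_wpmul2l ?lee_fin// (_ : 1 - 2 * e = (1 - e) - e); last by ring.
    have r1 : 0 < r^-1 by rewrite invr_gt0.
    have kN : 0 <= k ^+ N by rewrite exprn_ge0// (le_trans l0).
    rewrite EFinB leeB//.
      apply: le_trans (integral_indic_hat_ge mE r0 _); last by case: rp => *; lra.
      rewrite EFinB leeB// (_ : e = r^-1 * (e * r)); last by rewrite mulrCA mulVf ?mulr1// gt_eqF.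
      by rewrite EFinM lee_pmul2l// lte_fin.
    apply: le_trans (integral_indic_hat_le _ mE r0) _.
    rewrite (_ : e%:E = (r^-1)%:E * (e * r)%:E)%E ?lee_pmul2l//.
    by rewrite -EFinM mulrCA mulVf ?mulr1// gt_eqF.
  have := pE _ e0; have := qE _ e0; rewrite setCK => q1 p1.
  have lim (u v : R) : u < v -> \forall r \near 0^'+, u + r < v.
    by move=> uv; near=> r; rewrite -ltrBrDl; near: r; apply: nbhs_right_lt; rewrite subr_gt0.
  have := @filter_ex _ (0 : R)^'+ _; apply.
  near=> r; split.
  - by near: r; exact: nbhs_right_gt.
  - split; last by near: r; exact: lim.
    by rewrite ltrBrDr; near: r; exact: lim.
  - split; last by near: r; exact: lim.
    by rewrite ltrBrDr; near: r; exact: lim.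
  - by near: r.
  - by near: r.
apply/lee_addgt0Pr => e e0.
have c1 : 0 < c + 1 by lra.
(* The denominator uses [c + 1] since [c] may be 0; the loss [2 * c * (e / (2 * (c + 1)))] is still
   at most [e]. *)
have e1 : 0 < e / (2 * (c + 1)) by rewrite divr_gt0// mulr_gt0.
rewrite -leeBlDr//; apply: le_trans (key _ e1).
rewrite -EFinB lee_fin.
have : c * (2 * (e / (2 * (c + 1)))) <= e.
  rewrite (_ : c * (2 * (e / (2 * (c + 1)))) = e * (c / (c + 1))); last first.
    by field; rewrite gt_eqF.
  by rewrite ler_piMr ?(ltW e0)// ler_pdivrMr//; lra.
by lra.
Unshelve. all: by end_near. Qed.

End perimeter_ge.

(** * The extremal problem on the line *)

Section tail.
Context {R : realType}.
(* F x is the measure of E `&` ]x, Lam[, p is the perimeter divided by N omega, and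
   g x is x^((N-1)/N). *)
Variables (lam Lam p : R) (g F : R -> R).
Hypotheses (lL : lam < Lam).
Let m := (lam + Lam) / 2.
(** [vm] is the volume constraint; [gp] is the perimeter bound at a radius beyond which [E] is
    neither null nor of full measure; [pv] says that the quotient of [D] does not exceed the
    expected constant. [g_left] and [g_ratio] are properties of the power function. *)
Hypotheses
  (Fle : forall x y, lam <= x -> x <= y -> y <= Lam -> F y <= F x /\ F x <= F y + (y - x))
  (FL : F Lam = 0) (v0 : 0 < F lam) (vm : F lam <= (Lam - lam) / 2)
  (gp : forall x, lam <= x -> x < Lam -> 0 < F x -> F x < Lam - x -> g x <= p)
  (gm0 : 0 < g m) (g_incr : forall x, m < x -> g m < g x)
  (g_left : forall b, lam < b -> b <= m -> (forall x, lam <= x -> x < b -> g x <= p) -> g b <= p)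
  (g_ratio : forall b, lam < b -> b < m -> g m * (b - lam) < g b * (m - lam))
  (pv : p * (m - lam) <= g m * F lam).

Let lm : lam < m. Proof. by have := lL; rewrite /m; lra. Qed.
Let mL : m < Lam. Proof. by have := lL; rewrite /m; lra. Qed.
Let mE : m - lam = (Lam - lam) / 2. Proof. by rewrite /m; field. Qed.

Let Fge0 x : lam <= x -> x <= Lam -> 0 <= F x.
Proof. by move=> lx xL; have [+ _] := Fle lx xL (lexx _); rewrite FL. Qed.

Let Fsub x : lam <= x -> x <= Lam -> F x <= Lam - x.
Proof. by move=> lx xL; have [_] := Fle lx xL (lexx _); rewrite FL add0r. Qed.

Let p_le : p <= g m.
Proof.
have ml : 0 < m - lam by rewrite subr_gt0.
rewrite -(ler_pM2r ml); apply: le_trans pv _.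
by rewrite ler_wpM2l ?(ltW gm0)// mE.
Qed.

Let tail_m : F m = 0 \/ F m = Lam - m.
Proof.
have Fm0 := Fge0 (ltW lm) (ltW mL); have FmL := Fsub (ltW lm) (ltW mL).
have [->|/eqP F0] := eqVneq (F m) 0; first by left.
have [->|/eqP F1] := eqVneq (F m) (Lam - m); first by right.
have {}F0 : 0 < F m by rewrite lt_neqAle Fm0 andbT eq_sym; apply/eqP.
have {}F1 : F m < Lam - m by rewrite lt_neqAle FmL andbT; apply/eqP.
(* Small enough that [E] and its complement both still have positive measure beyond [m + t], since
   [F] loses at most [t]. Then [gp] gives [g (m + t) <= p <= g m], against strict monotonicity. *)
pose t := Num.min (F m) (Lam - m - F m) / 2.
have [t0 t1 t2] : [/\ 0 < t, t < F m & t < Lam - m - F m].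
  rewrite /t; have [?|?] := leP (F m) (Lam - m - F m); split; lra.
have lmt : lam <= m + t by have := lm; lra.
have mtL : m + t <= Lam by lra.
have [h1 h2] := Fle (ltW lm) (ltac:(lra) : m <= m + t) mtL.
have : g (m + t) <= p by apply: gp => //; lra.
have /g_incr : m < m + t by lra.
by have := p_le; lra.
Qed.

(** It suffices to prove [g m <= p]: together with [p_le] this gives [p = g m], and [pv] then forces
    [F lam] up to the maximum allowed by [vm]. *)
Lemma tail_rigidity :
  [/\ p = g m, F lam = m - lam & F m = 0 \/ F m = Lam - m].
Proof.
have ml : 0 < m - lam by rewrite subr_gt0.
suff gmp : g m <= p.
  have pE : p = g m by apply/eqP; rewrite eq_le p_le gmp.
  split; [exact: pE| |exact: tail_m].
  apply/eqP; rewrite eq_le {1}mE vm /= -(ler_pM2l gm0); move: pv; rewrite pE.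
  by [].
have [Fm|Fm] := tail_m.
  pose S : set R := [set x | lam <= x <= m /\ F x = 0].
  have Sm : S m by split=> //; rewrite (ltW lm) lexx.
  have Si : has_inf S.
    by split; [exists m|exists lam => x [/andP[]]].
  have Slb x : S x -> inf S <= x by move=> Sx; apply: ge_inf => //; case: Si.
  (* b^(1/N) is the outermost boundary radius. *)
  pose b := inf S.
  have bm : b <= m := Slb _ Sm.
  have lb : lam <= b by apply: lb_le_inf; [exists m|move=> x [/andP[]]].
  have Fb : F b = 0.
    (* The infimum is itself a zero because [F] is 1-Lipschitz. *)
    apply/eqP; rewrite eq_le Fge0 ?(le_trans bm (ltW mL))// andbT.
    apply/ler_addgt0Pr => e e0; rewrite add0r.
    have [x Sx xb] := inf_adherent e0 Si; have bx := Slb _ Sx.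
    have [/andP[lx xm] Fx] := Sx.
    have [_] := Fle lb bx (le_trans xm (ltW mL)).
    by move: xb; rewrite Fx -/b; lra.
  have lb' : lam < b.
    by rewrite lt_neqAle lb andbT; apply: contra_eqN Fb => /eqP <-; rewrite gt_eqF.
  have gb : g b <= p.
    apply: g_left => // x lx xb; have xm := lt_le_trans xb bm; have xL := lt_trans xm mL.
    have Fx0 : F x != 0.
      apply/eqP => Fx; have : S x by split => //; rewrite lx ltW.
      by move=> /Slb; rewrite leNgt xb.
    apply: gp => //; first by rewrite lt_neqAle eq_sym Fx0 Fge0// ltW.
    by have [_] := Fle lx (ltW xm) (ltW mL); rewrite Fm; have := mL; lra.
  have vb : F lam <= b - lam.
    by have [_] := Fle (lexx _) lb (le_trans bm (ltW mL)); rewrite Fb add0r.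
  (* If [b < m], then [p (m - lam) >= g b (m - lam) > g m (b - lam) >= g m F lam], which contradicts
     [pv]. *)
  move: bm; rewrite le_eqVlt => /predU1P[<-//|bm].
  have := g_ratio lb' bm.
  have : g m * F lam <= g m * (b - lam) by rewrite ler_pM2l.
  have : g b * (m - lam) <= p * (m - lam) by rewrite ler_pM2r.
  by have := pv; lra.
(* [E] is full beyond [m]. For [x < m], [F x >= F m > 0], while [F x <= F lam <= Lam - m < Lam - x]
   by the volume constraint: [gp] applies at every such [x]. *)
apply: g_left => // x lx xm; have xL := lt_trans xm mL.
have [h1 h2] := Fle lx (ltW xm) (ltW mL).
have [h3 _] := Fle (lexx _) lx (ltW xL).
have h4 := mE.
by apply: gp => //; have := mL; have := vm; move: h1 h2 h3 h4 Fm xm; lra.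
Qed.

End tail.

(** * The function [x^((N-1)/N)] *)

Section root_power.
Context {R : realType} (N : nat) (N2 : (2 <= N)%N).

Definition root_pow (x : R) : R := (x `^ N%:R^-1) ^+ N.-1.

Let N0 : (0 < N)%N. Proof. exact: leq_trans N2. Qed.
Let N1 : (0 < N.-1)%N. Proof. by rewrite -ltnS prednK. Qed.

Lemma root_lt (x y : R) : 0 <= x -> x < y -> x `^ N%:R^-1 < y `^ N%:R^-1.
Proof.
move=> x0 xy; rewrite -(@ltr_pXn2r _ N) ?nnegrE ?powR_ge0//.
by rewrite !root_exprn// (le_trans x0 (ltW xy)).
Qed.

Lemma root_pow_gt0 (x : R) : 0 < x -> 0 < root_pow x.
Proof. by move=> x0; rewrite exprn_gt0// powR_gt0. Qed.

Lemma root_pow_lt (x y : R) : 0 <= x -> x < y -> root_pow x < root_pow y.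
Proof.
move=> x0 xy; rewrite ltr_pXn2r ?nnegrE ?powR_ge0//; exact: root_lt.
Qed.

(** After the substitution [x = t^N] only the left continuity of [t^(N-1)] is needed. *)
Lemma root_pow_left (a b p : R) : 0 <= a -> a < b ->
  (forall x, a <= x -> x < b -> root_pow x <= p) -> root_pow b <= p.
Proof.
move=> a0 ab h.
set al := a `^ N%:R^-1; set be := b `^ N%:R^-1.
have albe : al < be by exact: root_lt.
have al0 : 0 <= al by exact: powR_ge0.
have c : (fun t : R => t ^+ N.-1) @ be^'- --> be ^+ N.-1.
  by apply: cvg_at_left_filter; exact: exprn_continuous.
rewrite -/be /root_pow -(cvg_lim _ c)//; apply: limr_le.
  by apply/cvg_ex; exists (be ^+ N.-1).
near=> t; have tb : t < be by near: t; exact: nbhs_left_lt.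
have ta : al <= t by near: t; exact: nbhs_left_ge.
have t0 : 0 <= t by exact: le_trans ta.
have := h (t ^+ N); rewrite /root_pow exprn_root//; apply.
  by rewrite -[leLHS](root_exprn N0 a0) lerXn2r.
by rewrite -[ltRHS](root_exprn N0 (le_trans a0 (ltW ab))) ltr_pXn2r ?nnegrE ?powR_ge0.
Unshelve. all: by end_near. Qed.

(** With [be], [ga] the roots of [b], [c] and [B], [G] their powers [N - 1], one has [b = be B],
    [c = ga G], and the difference of the two sides is [B G (ga - be) + a (G - B)]. *)
Lemma root_pow_ratio (a b c : R) : 0 <= a -> a < b -> b < c ->
  root_pow c * (b - a) < root_pow b * (c - a).
Proof.
move=> a0 ab bc; have b0 := le_lt_trans a0 ab; have c0 := lt_trans b0 bc.
rewrite -[X in _ * (X - a) < _](root_exprn N0 (ltW b0)).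
rewrite -[X in _ < _ * (X - a)](root_exprn N0 (ltW c0)) /root_pow.
have := root_lt (ltW b0) bc; have : 0 < b `^ N%:R^-1 by rewrite powR_gt0.
have : 0 < c `^ N%:R^-1 by rewrite powR_gt0.
move: (b `^ _) (c `^ _) => be ga ga0 be0 bega.
have e t : t ^+ N = t * t ^+ N.-1 :> R by rewrite -exprS prednK.
rewrite !e.
have : be ^+ N.-1 < ga ^+ N.-1 by rewrite ltr_pXn2r ?nnegrE ?ltW.
have : 0 < be ^+ N.-1 by rewrite exprn_gt0.
move: (be ^+ _) (ga ^+ _) => B G B0 BG.
have : 0 < B * G * (ga - be) by rewrite !mulr_gt0 ?subr_gt0// (lt_trans B0).
have : 0 <= a * (G - B) by rewrite mulr_ge0// subr_ge0 ltW.
lra.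
Qed.

End root_power.

(** * From radial sets to sets of reals *)

Section radial_profile.
Context {R : realType} {N : nat} (N0 : (0 < N)%N).
Notation lebN := (@lebesgue_rV R N).
Notation leb := (@lebesgue_measure R).
Notation omega := (@unit_ball_volume R N).

Lemma annulusE (s t : R) : 0 <= s -> 0 <= t ->
  @annulus R N s t = @enormN R N @^-1` `[s ^+ N, t ^+ N[.
Proof.
move=> s0 t0; apply/seteqP; split => x; rewrite /annulus /eball /= in_itv /=
  /enormN ltr_pXn2r ?nnegrE ?enorm_ge0// ler_pXn2r ?nnegrE ?enorm_ge0//.
  by move=> [-> /negP]; rewrite -leNgt => ->.
by move=> /andP[sx ->]; split => //; apply/negP; rewrite -leNgt.
Qed.

Lemma lebesgue_annulus (s t : R) : 0 <= s -> s <= t ->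
  lebN (annulus s t) = (omega * (t ^+ N - s ^+ N))%:E.
Proof.
move=> s0 st; have t0 := le_trans s0 st.
rewrite annulusE// lebesgue_enormN//.
rewrite setIidl.
  rewrite lebesgue_measure_itv /= lte_fin.
  case: ltP => [_|]; first by rewrite -EFinB -EFinM.
  move=> ts; have -> : t ^+ N = s ^+ N by apply/eqP; rewrite eq_le ts lerXn2r ?nnegrE.
  by rewrite subrr mulr0 mule0.
move=> x /=; rewrite !in_itv /= andbT => /andP[sx _].
by rewrite (le_trans _ sx)// exprn_ge0.
Qed.

(** [E] is the trace of the radial representative on a coordinate half-axis, parametrised by the
    N-th power of the norm. The point [f (|x|^N)] has the same norm as [x], hence the same
    membership in [S]. *)
Lemma radial_profile (l L : R) (D : set 'rV[R]_N) : 0 <= l -> l < L ->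
  measurable D -> D `<=` annulus l L -> radially_symmetric D ->
  exists E : set (measurableTypeR R), [/\ measurable E, E `<=` `[l ^+ N, L ^+ N[ &
    {ae lebN, forall x, D x <-> E (enormN x)}].
Proof.
move=> l0 lL mD DO [S [mS Srad DS]].
pose i0 := Ordinal N0.
pose f (s : measurableTypeR R) : 'rV[R]_N := (s `^ N%:R^-1) *: delta_mx 0 i0.
have mf : measurable_fun setT f.
  apply: measurable_fun_rV => i; rewrite /f; under eq_fun do rewrite mxE.
  by apply: measurable_funM => //; exact: measurable_powR.
pose E := f @^-1` S `&` (`[l ^+ N, L ^+ N[%classic : set (measurableTypeR R)).
have ef (x : 'rV[R]_N) : enorm (f (enormN x)) = enorm x.
  rewrite /f /enormN enormZ ger0_norm ?powR_ge0//. rewrite exprn_root ?enorm_ge0//.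
  rewrite [enorm (delta_mx _ _)]/enorm (bigD1 i0)//= big1 ?addr0.
    by rewrite mxE !eqxx expr1n sqrtr1 mulr1.
  by move=> j ji; rewrite mxE eqxx (negbTE ji) expr0n.
exists E; split.
- by apply: measurableI => //; rewrite -[X in measurable X]setTI; exact: mf.
- exact: subIsetr.
apply: filterS DS => x DSx; split.
  move=> Dx; split; first by apply: Srad (DSx.1 Dx); rewrite ef.
  by have := DO _ Dx; rewrite annulusE ?(ltW (le_lt_trans l0 lL)).
by move=> [Sx _]; apply/DSx; apply: Srad Sx; rewrite ef.
Qed.

Lemma measure_profile (D : set 'rV[R]_N) (E : set (measurableTypeR R)) :
  measurable D -> measurable E -> E `<=` `[0, +oo[ ->
  {ae lebN, forall x, D x <-> E (enormN x)} -> lebN D = (omega%:E * leb E)%E.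
Proof.
move=> mD mE E0 DE.
have -> : leb E = leb (E `&` `[0%R, +oo[) by rewrite setIidl.
rewrite -(lebesgue_enormN N0 mE).
have mE' : measurable (@enormN R N @^-1` E) := measurable_enormN_pre mE.
have : (\int[lebN]_x (\1_D x)%:E = \int[lebN]_x (\1_(@enormN R N @^-1` E) x)%:E)%E.
  apply: ae_eq_integral => //.
  - by apply/measurable_EFinP; exact: measurable_indic.
  - by apply/measurable_EFinP; exact: measurable_indic.
  apply: filterS DE => x DEx _ /=; rewrite !indicE; congr (nat_of_bool _)%:R%:E.
  by apply/idP/idP; rewrite !inE => /DEx.
by rewrite !integral_indic// !setIT.
Qed.

Lemma ae_profile (D : set 'rV[R]_N) (E I : set (measurableTypeR R)) :
  measurable E -> measurable I -> {ae lebN, forall x, D x <-> E (enormN x)} ->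
  leb (E `&` ~` I) = 0%E -> leb (~` E `&` I) = 0%E ->
  {ae lebN, forall x, D x <-> I (enormN x)}.
Proof.
move=> mE mI DE EI IE.
have mEI : measurable (E `&` ~` I) by apply: measurableI => //; exact: measurableC.
have mIE : measurable (~` E `&` I) by apply: measurableI => //; exact: measurableC.
have null (Z : set (measurableTypeR R)) : measurable Z -> leb Z = 0%E ->
    {ae lebN, forall x, ~ Z (enormN x)}.
  move=> mZ Z0; exists (@enormN R N @^-1` Z); split.
  - exact: measurable_enormN_pre.
  - rewrite lebesgue_enormN// (subset_measure0 _ mZ _ Z0) ?mule0//.
    by apply: measurableI => //; exact: measurable_itv.
  - by move=> x /=; apply: contra_notP => Zx; exact: Zx.
apply: filterS3 DE (null _ mEI EI) (null _ mIE IE) => x DEx h1 h2; split.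
  by move=> /DEx Ex; apply: contrapT => Ix; exact: h1.
by move=> Ix; apply/DEx; apply: contrapT => Ex; exact: h2.
Qed.

Lemma perimeter_ge0 (D Omega : set 'rV[R]_N) : (0 <= perimeter D Omega)%E.
Proof.
have p0 i j : partial i (fun y : 'rV[R]_N => (cst 0 : 'rV[R]_N -> 'rV[R]_N) y 0 j) = cst 0.
  by apply/funext => x; rewrite /partial /=; under eq_fun do rewrite mxE; rewrite derive_cst.
apply: ereal_sup_ubound; exists (cst 0).
  have s0 : supp (cst 0 : 'rV[R]_N -> 'rV[R]_N) = set0.
    by rewrite /supp (_ : mkset _ = set0) ?closure0//; apply/seteqP; split => x //=; rewrite eqxx.
  split.
  - split; first by move=> x; exact: differentiable_cst.
    by move=> i j; rewrite p0 => x; exact: cst_continuous.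
  - by rewrite s0; exact: compact0.
  - by rewrite s0.
  - by move=> x; rewrite /enorm big1 ?sqrtr0// => i _; rewrite mxE expr0n.
rewrite integral0_eq// => x _; rewrite /divergence big1 ?mulr0// => i _.
by rewrite p0.
Qed.

End radial_profile.

Section tail_measure.
Context {R : realType}.
Notation leb := (@lebesgue_measure R).
Variables (lam Lam : R) (lL : lam < Lam) (E : set (measurableTypeR R)) (mE : measurable E).

Definition tail_measure (A : set (measurableTypeR R)) (x : R) : R :=
  fine (leb (A `&` `]x, Lam[)).

Let mT (A : set (measurableTypeR R)) x : measurable A -> measurable (A `&` `]x, Lam[).
Proof. by move=> mA; apply: measurableI => //; exact: measurable_itv. Qed.

Lemma tail_measureE (A : set (measurableTypeR R)) x : measurable A ->
  leb (A `&` `]x, Lam[) = (tail_measure A x)%:E.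
Proof.
move=> mA; rewrite fineK// ge0_fin_numE//.
apply: (@le_lt_trans _ _ (leb (`]x, Lam[%classic : set (measurableTypeR R)))).
  by apply: le_measure; rewrite ?inE//; exact: mT.
by rewrite lebesgue_measure_itv /=; case: ifP; rewrite -?EFinB ltry.
Qed.

Lemma tail_measure_split (A : set (measurableTypeR R)) x y : measurable A ->
  x <= y -> y < Lam ->
  leb (A `&` `]x, y]) = (tail_measure A x - tail_measure A y)%:E.
Proof.
move=> mA xy yL.
have m1 : measurable (A `&` `]x, y]) by apply: measurableI => //; exact: measurable_itv.
have : leb (A `&` `]x, Lam[) = (leb (A `&` `]x, y]) + leb (A `&` `]y, Lam[))%E.
  rewrite -measureU//; last 2 first.
  - exact: mT.
  - apply/seteqP; split => s //= [[_ +] [_]]; rewrite !in_itv /= => /andP[_ sy] /andP[ys _].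
    by move: (lt_le_trans ys sy); rewrite ltxx.
  rewrite -setIUr; congr (leb (_ `&` _)).
  by rewrite (@itv_bndbnd_setU _ _ (BRight x) (BRight y) (BLeft Lam)).
rewrite !tail_measureE// EFinB => ->.
by rewrite addeK.
Qed.

Lemma tail_measureC x : x <= Lam -> tail_measure E x + tail_measure (~` E) x = Lam - x.
Proof.
move=> xL; apply: EFin_inj; rewrite EFinD -!tail_measureE//; last exact: measurableC.
rewrite -measureU//; last 3 first.
- exact: mT.
- by apply: mT; exact: measurableC.
- by apply/seteqP; split => s //= [[Es _] []].
rewrite -setIUl setUv setTI [LHS](_ : _ = leb `]x, Lam[%classic)//.
rewrite lebesgue_measure_itv /= lte_fin -EFinB.
by move: xL; rewrite le_eqVlt => /predU1P[->|->]//; rewrite ltxx subrr.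
Qed.

Lemma tail_measure_ge0 A x : 0 <= tail_measure A x.
Proof. by rewrite fine_ge0. Qed.

Lemma tail_measure_Lam A : tail_measure A Lam = 0.
Proof. by rewrite /tail_measure set_itvoo0 setI0 measure0. Qed.

(** The tails of [E] and of its complement are both nonincreasing and add up to [Lam - x], so
    neither can drop faster than [y - x]. *)
Lemma tail_measure_le x y : x <= y -> y <= Lam ->
  tail_measure E y <= tail_measure E x /\ tail_measure E x <= tail_measure E y + (y - x).
Proof.
move=> + yL; move: yL; rewrite le_eqVlt => /predU1P[->|yL].
  rewrite le_eqVlt => /predU1P[->|xL]; first by rewrite lexx subrr addr0.
  have := tail_measureC (ltW xL); rewrite tail_measure_Lam.
  by have := tail_measure_ge0 E x; have := tail_measure_ge0 (~` E) x; split; lra.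
move=> xy; have cE := measurableC mE.
have h1 : 0 <= tail_measure E x - tail_measure E y.
  by rewrite -lee_fin -tail_measure_split.
have h2 : 0 <= tail_measure (~` E) x - tail_measure (~` E) y.
  by rewrite -lee_fin -tail_measure_split.
have := tail_measureC (ltW (le_lt_trans xy yL)); have := tail_measureC (ltW yL).
by split; lra.
Qed.

End tail_measure.

(** * Minimizers and the value of the constant *)

Section rigidity.
Context {R : realType} {N : nat} (N2 : (2 <= N)%N).
Notation lebN := (@lebesgue_rV R N).
Notation leb := (@lebesgue_measure R).
Notation omega := (@unit_ball_volume R N).
Variables (l L : R) (l0 : 0 <= l) (lL : l < L).
Let lam := l ^+ N.
Let Lam := L ^+ N.
Let m := (lam + Lam) / 2.
Let Omega : set 'rV[R]_N := annulus l L.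
(** The quotient of [N omega r*^(N-1)] by [omega (r*^N - l^N)], written with [m = r*^N]. *)
Let K : R := N%:R * root_pow N m / (m - lam).

Let N0 : (0 < N)%N. Proof. exact: leq_trans N2. Qed.
Let w0 : 0 < omega. Proof. exact: unit_ball_volume_gt0. Qed.
Let NR0 : 0 < N%:R :> R. Proof. by rewrite ltr0n. Qed.
Let lam0 : 0 <= lam. Proof. exact: exprn_ge0. Qed.
Let L0 : 0 < L. Proof. exact: le_lt_trans l0 lL. Qed.
Let lamLam : lam < Lam. Proof. by rewrite ltr_pXn2r ?nnegrE// ltW. Qed.
Let lm : lam < m. Proof. by have := lamLam; rewrite /m; lra. Qed.
Let mL : m < Lam. Proof. by have := lamLam; rewrite /m; lra. Qed.
Let m0 : 0 < m. Proof. exact: le_lt_trans lam0 lm. Qed.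
Let mE : m - lam = (Lam - lam) / 2. Proof. by rewrite /m; field. Qed.

(** Absorbs the single endpoint by which the half-open intervals of annuli differ from the open
    intervals of [tail_measure]. *)
Lemma null_cover (Z Y : set (measurableTypeR R)) (p : R) : measurable Z -> measurable Y ->
  Z `<=` [set p] `|` Y -> leb Y = 0%E -> leb Z = 0%E.
Proof.
move=> mZ mY ZY Y0; apply/eqP; rewrite -measure_le0.
have mp : measurable ([set p] : set (measurableTypeR R)) by exact: measurable_set1.
apply: (@le_trans _ _ (leb ([set p] `|` Y))).
  by apply: le_measure; rewrite ?inE//; exact: measurableU.
apply: (@le_trans _ _ (leb [set p] + leb Y)%E); first exact: measureU2.
by rewrite Y0 adde0 [leLHS](lebesgue_measure_set1 p).
Qed.

Let rstar : R := m `^ N%:R^-1.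
Let rstarN : rstar ^+ N = m. Proof. by rewrite root_exprn// ltW. Qed.
Let rstar_ge : l < rstar.
Proof. by rewrite -(exprn_root N0 l0); exact: root_lt. Qed.
Let rstar_le : rstar < L.
Proof. by rewrite -(exprn_root N0 (ltW L0)); apply: root_lt => //; exact: ltW. Qed.

(** Assuming only an inequality serves twice: no admissible set can do better than [K], and a
    minimizer, whose quotient is [K], has one of the two shapes. *)
Lemma radial_ratio_rigidity (D : set 'rV[R]_N) : rad_admissible Omega D ->
  (perimeter D Omega / lebN D <= K%:E)%E ->
  (perimeter D Omega / lebN D = K%:E)%E /\
  ({ae lebN, forall x, D x <-> annulus l rstar x} \/
   {ae lebN, forall x, D x <-> annulus rstar L x}).
Proof.
move=> [mD DO rad D0 Dh].
have [E [mEE EI DE]] := radial_profile N0 l0 lL mD DO rad.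
rewrite -/lam -/Lam in EI.
have EI' : E `<=` `[0%R, +oo[.
  move=> s /EI /=; rewrite !in_itv /= andbT => /andP[+ _]; exact: le_trans.
have CE := measurableC mEE.
pose F := tail_measure Lam E.
have EF : leb E = (F lam)%:E.
  rewrite -tail_measureE//.
  have mI : measurable (`]lam, Lam[%classic : set (measurableTypeR R)) by exact: measurable_itv.
  rewrite [LHS](measureDI leb mEE mI)//.
  rewrite [X in (X + _)%E](_ : _ = 0%E) ?add0e//.
  apply: (@null_cover _ set0 lam) => //; first exact: measurableD.
  move=> s [/EI]; rewrite /= !in_itv /= => /andP[s1 s2] s3; left.
  apply/eqP; rewrite eq_le s1 andbT leNgt; apply/negP => s4; apply: s3.
  by rewrite s4.
have DE' : lebN D = (omega * F lam)%:E by rewrite (measure_profile N0 mD mEE EI' DE) EF.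
have v0 : 0 < F lam by move: D0; rewrite DE' lte_fin pmulr_rgt0.
have vm : F lam <= (Lam - lam) / 2.
  move: Dh; rewrite DE' /Omega lebesgue_annulus ?(ltW lL)// inver pnatr_eq0 /=.
  by rewrite -EFinM lee_fin -mulrA ler_pM2l.
have wv : 0 < omega * F lam by rewrite mulr_gt0.
rewrite DE' inver gt_eqF// => PK.
have {}PK : (perimeter D Omega <= (K * (omega * F lam))%:E)%E.
  by rewrite EFinM -lee_pdivrMr.
have [P0 PE] : exists P0, perimeter D Omega = P0%:E.
  exists (fine (perimeter D Omega)); rewrite fineK// ge0_fin_numE ?perimeter_ge0//.
  by rewrite (le_lt_trans PK)// ltry.
move: PK; rewrite PE lee_fin => PK.
have ml : 0 < m - lam by rewrite subr_gt0.
have Nw : 0 < N%:R * omega by rewrite mulr_gt0.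
have [] := @tail_rigidity R lam Lam (P0 / (N%:R * omega)) (root_pow N) F lamLam.
- by move=> x y _; exact: tail_measure_le.
- exact: tail_measure_Lam.
- exact: v0.
- exact: vm.
(* [perimeter_ge] at the radius [x^(1/N)]; the complement has positive measure beyond [x] because
   the two tails add up to [Lam - x]. *)
- move=> x lx xL F0 FL; have x0 := le_trans lam0 lx.
  rewrite ler_pdivlMr// mulrC.
  have := perimeter_ge N0 l0 (k := x `^ N%:R^-1) (L := L) _ _ mD mEE DE.
  rewrite root_exprn// -/Omega PE lee_fin !tail_measureE//= !lte_fin => h.
  have := h _ _ F0 _; rewrite mulrAC; apply.
  + by rewrite -[leLHS](exprn_root N0 l0) ge0_ler_powR ?nnegrE ?invr_ge0.
  + by rewrite -(exprn_root N0 (ltW L0)); exact: root_lt.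
  + by have := tail_measureC mEE (ltW xL); rewrite -/F; lra.
- exact: root_pow_gt0.
- by move=> x; apply: root_pow_lt; [exact: N2|exact: ltW].
- by move=> b lb _; exact: root_pow_left.
- by move=> b lb bm; exact: root_pow_ratio.
- rewrite -/m mulrAC ler_pdivrMr// -ler_pdivlMr//.
  apply: le_trans PK _; rewrite le_eqVlt; apply/orP; left; apply/eqP.
  by rewrite /K; field; rewrite gt_eqF.
rewrite -/m => pE vE Fm; split.
  rewrite -EFinM; congr EFin.
  have -> : P0 = root_pow N m * (N%:R * omega) by rewrite -pE divfK// gt_eqF.
  by rewrite vE /K; field; rewrite !gt_eqF.
have TC := tail_measureC mEE (ltW lamLam); have Tm := tail_measureC mEE (ltW mL).
have mI (a b : R) : measurable (`[a, b[%classic : set (measurableTypeR R)) by exact: measurable_itv.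
have mO (A : set (measurableTypeR R)) (a b : R) : measurable A -> measurable (A `&` `]a, b[).
  by move=> mA; apply: measurableI => //; exact: measurable_itv.
have mC (A : set (measurableTypeR R)) (a b : R) : measurable A -> measurable (A `&` `]a, b]).
  by move=> mA; apply: measurableI => //; exact: measurable_itv.
have split_lt (a s : R) : a <= s -> s = a \/ a < s.
  by rewrite le_eqVlt => /predU1P[->|]; [left|right].
case: Fm => Fm; [left|right].
  (* [E] is null beyond [m] and has measure [m - lam], so it fills []lam, m]]. *)
  rewrite annulusE ?powR_ge0// rstarN -/lam.
  apply: (ae_profile N0 mEE (mI lam m) DE).
    apply: (@null_cover _ (E `&` `]m, Lam[) m); [|exact: mO| |].
    - by apply: measurableI => //; exact: measurableC.
    - move=> s [Es]; have := EI _ Es; rewrite /= !in_itv /= => /andP[s1 s2].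
      rewrite s1 /= => /negP; rewrite -leNgt => /split_lt[->|s3]; [by left|right].
      by split => //; rewrite s3.
    - by rewrite tail_measureE// -/F Fm.
  apply: (@null_cover _ (~` E `&` `]lam, m]) lam); [|exact: mC| |].
  - by apply: measurableI.
  - move=> s [Es]; rewrite /= !in_itv /= => /andP[/split_lt[->|s1] s2]; [by left|right].
    by split => //; rewrite s1 ltW.
  - rewrite (tail_measure_split CE (ltW lm) mL); congr EFin.
    by move: TC Tm; rewrite -/F vE Fm; lra.
(* The part of [E] beyond [m] has measure [Lam - m = m - lam], already the whole measure of [E]:
   nothing is left in []lam, m]]. *)
rewrite annulusE ?powR_ge0 ?(ltW L0)// rstarN -/Lam.
apply: (ae_profile N0 mEE (mI m Lam) DE).
  apply: (@null_cover _ (E `&` `]lam, m]) lam); [|exact: mC| |].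
  - by apply: measurableI => //; exact: measurableC.
  - move=> s [Es]; have := EI _ Es; rewrite /= !in_itv /= => /andP[s1 s2].
    rewrite s2 andbT => /negP; rewrite -ltNge => s3.
    move: s1 => /split_lt[->|s1]; [by left|right].
    by split => //; rewrite s1 ltW.
  - rewrite (tail_measure_split mEE (ltW lm) mL); congr EFin.
    by rewrite -/F vE Fm mE /m; field.
apply: (@null_cover _ (~` E `&` `]m, Lam[) m); [|exact: mO| |].
- by apply: measurableI.
- move=> s [Es]; rewrite /= !in_itv /= => /andP[/split_lt[->|s1] s2]; [by left|right].
  by split => //; rewrite s1.
- rewrite tail_measureE//; congr EFin.
  by move: Tm; rewrite -/F Fm; lra.
Qed.

Lemma rad_admissible_inner : rad_admissible Omega (annulus l rstar).
Proof.
split.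
- exact: measurable_annulus.
- by move=> x [xr xl]; split => //; exact: lt_trans rstar_le.
- exists (annulus l rstar); split; first exact: measurable_annulus.
    by move=> x y xy; rewrite /annulus /eball /= xy.
  by apply: aeW.
- by rewrite lebesgue_annulus ?(ltW rstar_ge)// lte_fin mulr_gt0// rstarN subr_gt0.
rewrite !lebesgue_annulus ?(ltW rstar_ge) ?(ltW lL)// inver pnatr_eq0 /= -EFinM lee_fin.
by rewrite rstarN -/lam -/Lam mE mulrA.
Qed.

Lemma ratio_inner_le : (perimeter (annulus l rstar) Omega / lebN (annulus l rstar) <= K%:E)%E.
Proof.
have r0 : 0 < rstar by rewrite powR_gt0.
have wm : 0 < omega * (m - lam) by rewrite mulr_gt0// subr_gt0.
rewrite lebesgue_annulus ?(ltW rstar_ge)// rstarN -/lam inver gt_eqF//.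
apply: (@le_trans _ _ ((N%:R * omega * rstar ^+ N.-1)%:E * ((omega * (m - lam))^-1)%:E)%E).
  by rewrite lee_wpmul2r ?perimeter_annulus_le// lee_fin invr_ge0 ltW.
rewrite -EFinM lee_fin le_eqVlt; apply/orP; left; apply/eqP.
by rewrite /K /root_pow -/rstar; field; rewrite !gt_eqF// subr_gt0.
Qed.

(** The inner annulus gives one inequality. For the other, a quotient below [K] would equal [K] by
    [radial_ratio_rigidity]. *)
Lemma h_radE : h_rad Omega = K%:E.
Proof.
apply/eqP; rewrite eq_le; apply/andP; split.
  apply: le_trans ratio_inner_le; apply: ereal_inf_lbound.
  by exists (annulus l rstar) => //; exact: rad_admissible_inner.
apply: le_ereal_inf_tmp => _ [D aD <-].
rewrite leNgt; apply/negP => DK.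
by have [DE _] := radial_ratio_rigidity aD (ltW DK); move: DK; rewrite DE ltxx.
Qed.

Lemma radial_constantE : K = 2 `^ (N%:R^-1) * N%:R *
  ((L ^+ N + l ^+ N) `^ ((N%:R - 1) / N%:R) / (L ^+ N - l ^+ N)).
Proof.
have NN : N.-1%:R = N%:R - 1 :> R by rewrite -[in RHS](prednK N0) -natr1 addrK.
have N1 : N%:R != 0 :> R by rewrite gt_eqF.
have LL : Lam - lam != 0 by rewrite gt_eqF// subr_gt0.
pose a : R := (N%:R - 1) / N%:R.
(* The factor 2 comes from [m - lam = (Lam - lam) / 2], the power of [2^-1] from [m]; the exponents
   combine as [1 - (N - 1) / N = 1 / N]. *)
have two : (2^-1 : R) `^ a * 2 = 2 `^ N%:R^-1.
  rewrite -(@powR_inv1 _ 2)// -powRrM -[X in _ * X](@powRr1 _ 2)// -powRD ?pnatr_eq0 ?implybT//.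
  by congr (_ `^ _); rewrite /a; field.
have rE : root_pow N m = (L ^+ N + l ^+ N) `^ a * 2^-1 `^ a.
  rewrite /root_pow -powR_mulrn ?powR_ge0// -powRrM NN mulrC -/a -powRM ?invr_ge0//.
    by rewrite /m /lam /Lam [l ^+ N + _]addrC.
  by rewrite addr_ge0// exprn_ge0// ltW.
rewrite -/a -two /K rE mE -/Lam -/lam.
by field; rewrite LL.
Qed.

End rigidity.

Theorem lemma5p10 (R : realType) (N : nat) (l L : R)
    (hN : (2 <= N)%N) (hl : 0 <= l) (hlL : l < L) :
  let Omega : set 'rV[R]_N := annulus l L in
  let rstar : R := ((L ^+ N + l ^+ N) / 2) `^ (N%:R^-1) in
  (forall D : set 'rV[R]_N, h_rad_minimizer Omega D ->
     {ae @lebesgue_rV R N, forall x, D x <-> annulus l rstar x} \/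
     {ae @lebesgue_rV R N, forall x, D x <-> annulus rstar L x}) /\
  h_rad Omega =
    (2 `^ (N%:R^-1) * N%:R *
     ((L ^+ N + l ^+ N) `^ ((N%:R - 1) / N%:R) / (L ^+ N - l ^+ N)))%:E.
Proof.
move=> Omega rstar; rewrite -(radial_constantE hN hl hlL) /Omega (h_radE hN hl hlL).
split=> // D [aD]; rewrite (h_radE hN hl hlL) => DE.
rewrite /rstar addrC.
by have [] := radial_ratio_rigidity hN hl hlL aD; rewrite ?DE.
Qed.
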